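(* Let $(M,g_L,\nabla^Lu,\lambda,\rho)$ be a gradient Lyra almost Ricci--Bourguignon soliton on a connected Lyra twisted warped product $M=M_1\times_fM_2$ of dimension $n\ge3$. Then $g_L$ is Einstein if and only if $$\operatorname{Hess}^Lu=\psi g_L$$ for some smooth function $\psi$ on $M$. In this case $$\lambda=(1-n\rho)\mu+\psi,$$ where $\mu$ is the Einstein constant, $\operatorname{Ric}^L=\mu g_L$.
   Context: Lyra twisted warped product: $(M_1,g_1),(M_2,g_2)$ are smooth pseudo-Riemannian manifolds of positive dimensions $n_1,n_2$, $n=n_1+n_2$; $f,\varphi:M_1\times M_2\to(0,\infty)$ are smooth; $M=M_1\times M_2$ carries $g=g_1\oplus f^2g_2$ and $g_L=\varphi^2g$. $\operatorname{Ric}^L,R^L,\operatorname{Hess}^L$ are the Ricci tensor, scalar curvature and Hessian of $g_L$, and $\nabla^Lu$ is the $g_L$-gradient of $u\in C^\infty(M)$. A gradient Lyra almost Ricci--Bourguignon soliton consists of $u,\lambda\in C^\infty(M)$, $\rho\in\mathbb R$ with $\operatorname{Ric}^L+\operatorname{Hess}^Lu=(\lambda+\rho R^L)g_L$. $g_L$ is Einstein if $\operatorname{Ric}^L=\mu g_L$ for some constant $\mu\in\mathbb R$. *)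

(* Defs.v *)
From HB Require Import structures.
From mathcomp Require Import all_boot all_order all_algebra.
From mathcomp Require Import all_classical all_reals all_analysis.
Set Implicit Arguments.
Unset Strict Implicit.
Unset Printing Implicit Defensive.
Import Order.TTheory GRing.Theory Num.Theory.
Import numFieldNormedType.Exports.
Local Open Scope classical_set_scope.
Local Open Scope ring_scope.

Section Calculus.
Variables (R : realType) (n : nat).
Implicit Types (U : set 'rV[R]_n) (f g : 'rV[R]_n -> R).

Definition pderiv (a : 'I_n) f : 'rV[R]_n -> R := 'D_(delta_mx 0 a) f.

Fixpoint Ck (k : nat) U f : Prop :=
  (forall x, U x -> {for x, continuous f}) /\
  if k is k'.+1 then
    forall a, (forall x, U x -> derivable f x (delta_mx 0 a)) /\
              Ck k' U (pderiv a f)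
  else True.

Definition smooth_on U f : Prop := forall k, Ck k U f.

(* Row convention: the a-th row holds the derivatives along the a-th axis. *)
Definition jac m (t : 'rV[R]_n -> 'rV[R]_m) (x : 'rV[R]_n) : 'M[R]_(n, m) :=
  \matrix_(a, b) pderiv a (fun y => t y 0 b) x.

End Calculus.

Section CalculusTheory.
Variables (R : realType) (n : nat).
Implicit Types (U : set 'rV[R]_n) (f g : 'rV[R]_n -> R).

Lemma CkW k U f : Ck k.+1 U f -> Ck k U f.
Proof.
elim: k f => [|k IH] f [fc fd]; split => // a.
by have [fda Cfa] := fd a; split => //; exact: IH.
Qed.

Lemma CkS k V U f : V `<=` U -> Ck k U f -> Ck k V f.
Proof.
move=> VU; elim: k f => [|k IH] f [fc fd]; (split; first by move=> x /VU; exact: fc) => // a.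
by have [fda Cfa] := fd a; split => [x /VU|]; [exact: fda | exact: IH].
Qed.

Lemma near_eqU U f g x : open U -> (forall y, U y -> f y = g y) -> U x ->
  \near x, f x = g x.
Proof.
move=> Uo fg Ux; near=> y; apply: fg; near: y.
exact: open_nbhs_nbhs.
Unshelve. all: by end_near. Qed.

Lemma near_eq_continuous f g (x : 'rV[R]_n) : (\near x, f x = g x) ->
  {for x, continuous f} -> {for x, continuous g}.
Proof.
move=> fg; rewrite /prop_for /continuous_at -(nbhs_singleton fg) => fc.
apply: cvg_trans fc; exact: (@near_eq_cvg _ _ (nbhs x) _ f g fg).
Qed.

Lemma Ck_eq k U f g : open U -> (forall x, U x -> f x = g x) ->
  Ck k U f -> Ck k U g.
Proof.
move=> Uo; elim: k f g => [|k IH] f g fg [fc fd]; 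
  (split; first by move=> x Ux; apply: near_eq_continuous (near_eqU Uo fg Ux) _; exact: fc) => // a.
have [fda Cfa] := fd a; split => [x Ux|].
  exact: near_eq_derivable (near_eqU Uo fg Ux) (fda x Ux).
apply: IH Cfa => x Ux; exact: near_eq_derive (near_eqU Uo fg Ux).
Qed.

Lemma Ck_add k U f g : open U -> Ck k U f -> Ck k U g ->
  Ck k U (fun x => f x + g x).
Proof.
move=> Uo; elim: k f g => [|k IH] f g [fc fd] [gc gd];
  (split; first by move=> x Ux; exact: (continuousD (fc x Ux) (gc x Ux))) => // a.
have [fda Cfa] := fd a; have [gda Cga] := gd a; split => [x Ux|].
  by exact: (derivableD (fda x Ux) (gda x Ux)).
apply: Ck_eq (IH _ _ Cfa Cga) => // x Ux.
by rewrite /pderiv deriveD //; [exact: fda|exact: gda].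
Qed.

Lemma Ck_mul k U f g : open U -> Ck k U f -> Ck k U g ->
  Ck k U (fun x => f x * g x).
Proof.
move=> Uo; elim: k f g => [|k IH] f g Cf Cg; have [fc fd] := Cf;
  have [gc gd] := Cg; (split; first by move=> x Ux; exact: (continuousM (fc x Ux) (gc x Ux))) => // a.
have [fda Cfa] := fd a; have [gda Cga] := gd a; split => [x Ux|].
  by exact: (derivableM (fda x Ux) (gda x Ux)).
apply: Ck_eq (Ck_add Uo (IH _ _ (CkW Cf) Cga) (IH _ _ (CkW Cg) Cfa)) => // x Ux.
by rewrite /pderiv deriveM //; [exact: fda|exact: gda].
Qed.

Lemma pderiv_cst (c : R) a : pderiv a (fun=> c) = (fun=> 0) :> ('rV[R]_n -> R).
Proof. by apply/funext => x; rewrite /pderiv derive_cst. Qed.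

Lemma smooth_cst U (c : R) : smooth_on U (fun=> c).
Proof.
move=> k; elim: k c => [|k IH] c; (split; first by move=> x Ux; exact: (@cst_continuous _ _ c x)) => // a.
by split=> [x _|]; [exact: derivable_cst | rewrite pderiv_cst].
Qed.

End CalculusTheory.

Section BlockCalculus.
Variables (R : realType) (n1 n2 : nat).
Local Notation N := (n1 + n2)%N.

Lemma lsubmx_shift (h : R) (v x : 'rV[R]_N) :
  lsubmx (h *: v + x) = h *: lsubmx v + lsubmx x.
Proof. by rewrite linearD linearZ. Qed.

Lemma rsubmx_shift (h : R) (v x : 'rV[R]_N) :
  rsubmx (h *: v + x) = h *: rsubmx v + rsubmx x.
Proof. by rewrite linearD linearZ. Qed.

Lemma lsubmx_delta_l (a : 'I_n1) :
  lsubmx (delta_mx 0 (lshift n2 a) : 'rV[R]_N) = delta_mx 0 a.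
Proof. by apply/rowP => j; rewrite !mxE (inj_eq (@lshift_inj _ _)). Qed.

Lemma lsubmx_delta_r (a : 'I_n2) :
  lsubmx (delta_mx 0 (rshift n1 a) : 'rV[R]_N) = 0.
Proof. by apply/rowP => j; rewrite !mxE eq_lrshift. Qed.

Lemma rsubmx_delta_r (a : 'I_n2) :
  rsubmx (delta_mx 0 (rshift n1 a) : 'rV[R]_N) = delta_mx 0 a.
Proof. by apply/rowP => j; rewrite !mxE (inj_eq (@rshift_inj _ _)). Qed.

Lemma rsubmx_delta_l (a : 'I_n1) :
  rsubmx (delta_mx 0 (lshift n2 a) : 'rV[R]_N) = 0.
Proof. by apply/rowP => j; rewrite !mxE eq_rlshift. Qed.

Lemma derivable_proj m (p : 'rV[R]_N -> 'rV[R]_m) (f : 'rV[R]_m -> R) x v :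
  (forall (h : R) v x, p (h *: v + x) = h *: p v + p x) ->
  derivable f (p x) (p v) -> derivable (f \o p) x v.
Proof.
move=> pE; by rewrite /derivable /=; under [in X in _ -> X]eq_fun do rewrite pE.
Qed.

Lemma derive_proj m (p : 'rV[R]_N -> 'rV[R]_m) (f : 'rV[R]_m -> R) x v :
  (forall (h : R) v x, p (h *: v + x) = h *: p v + p x) ->
  'D_v (f \o p) x = 'D_(p v) f (p x).
Proof. by move=> pE; rewrite /derive /=; under eq_fun do rewrite pE. Qed.

Lemma pderiv_ll (f : 'rV[R]_n1 -> R) a :
  pderiv (lshift n2 a) (f \o lsubmx) = pderiv a f \o lsubmx.
Proof.
apply/funext => x; rewrite /pderiv (derive_proj _ _ _ lsubmx_shift) /=.
by rewrite lsubmx_delta_l.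
Qed.

Lemma pderiv_lr (f : 'rV[R]_n1 -> R) a :
  pderiv (rshift n1 (a : 'I_n2)) (f \o lsubmx) = (fun=> 0).
Proof.
apply/funext => x; rewrite /pderiv (derive_proj _ _ _ lsubmx_shift) /=.
by rewrite lsubmx_delta_r derive0.
Qed.

Lemma pderiv_rr (f : 'rV[R]_n2 -> R) a :
  pderiv (rshift n1 a) (f \o rsubmx) = pderiv a f \o rsubmx.
Proof.
apply/funext => x; rewrite /pderiv (derive_proj _ _ _ rsubmx_shift) /=.
by rewrite rsubmx_delta_r.
Qed.

Lemma pderiv_rl (f : 'rV[R]_n2 -> R) a :
  pderiv (lshift n2 (a : 'I_n1)) (f \o rsubmx) = (fun=> 0).
Proof.
apply/funext => x; rewrite /pderiv (derive_proj _ _ _ rsubmx_shift) /=.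
by rewrite rsubmx_delta_l derive0.
Qed.

Lemma smooth_lsubmx (U : set 'rV[R]_n1) f :
  smooth_on U f -> smooth_on (lsubmx @^-1` U) (f \o @lsubmx R 1 n1 n2).
Proof.
move=> + k => /(_ k); elim: k f => [|k IH] f [fc fd];
  (split; first by move=> x Ux; apply: continuous_comp; [exact: continuous_lsubmx|exact: fc]) => // a.
case: (split_ordP a) => b ->.
  have [fdb Cfb] := fd b; split=> [x Ux|]; last by rewrite pderiv_ll; exact: IH.
  by apply: (derivable_proj lsubmx_shift); rewrite lsubmx_delta_l; exact: fdb.
split=> [x Ux|]; last by rewrite pderiv_lr; exact: smooth_cst.
by apply: (derivable_proj lsubmx_shift); rewrite lsubmx_delta_r; exact: derivable0.
Qed.

Lemma smooth_rsubmx (U : set 'rV[R]_n2) f :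
  smooth_on U f -> smooth_on (rsubmx @^-1` U) (f \o @rsubmx R 1 n1 n2).
Proof.
move=> + k => /(_ k); elim: k f => [|k IH] f [fc fd];
  (split; first by move=> x Ux; apply: continuous_comp; [exact: continuous_rsubmx|exact: fc]) => // a.
case: (split_ordP a) => b ->.
  split=> [x Ux|]; last by rewrite pderiv_rl; exact: smooth_cst.
  by apply: (derivable_proj rsubmx_shift); rewrite rsubmx_delta_l; exact: derivable0.
have [fdb Cfb] := fd b; split=> [x Ux|]; last by rewrite pderiv_rr; exact: IH.
by apply: (derivable_proj rsubmx_shift); rewrite rsubmx_delta_r; exact: fdb.
Qed.

Lemma jac_block m1 m2 (s : 'rV[R]_n1 -> 'rV[R]_m1) (t : 'rV[R]_n2 -> 'rV[R]_m2) x :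
  jac (fun y : 'rV[R]_N => row_mx (s (lsubmx y)) (t (rsubmx y))) x =
  block_mx (jac s (lsubmx x)) 0 0 (jac t (rsubmx x)).
Proof.
apply/matrixP => a b.
case: (split_ordP a) => c ->; case: (split_ordP b) => d ->;
  rewrite ?(block_mxEul, block_mxEur, block_mxEdl, block_mxEdr) !mxE.
- transitivity (pderiv (lshift n2 c) ((fun y => s y 0 d) \o lsubmx) x).
    by congr (pderiv _ _ x); apply/funext => y; rewrite row_mxEl.
  by rewrite pderiv_ll.
- transitivity (pderiv (lshift n2 c) ((fun y => t y 0 d) \o rsubmx) x).
    by congr (pderiv _ _ x); apply/funext => y; rewrite row_mxEr.
  by rewrite pderiv_rl.
- transitivity (pderiv (rshift n1 c) ((fun y => s y 0 d) \o lsubmx) x).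
    by congr (pderiv _ _ x); apply/funext => y; rewrite row_mxEl.
  by rewrite pderiv_lr.
- transitivity (pderiv (rshift n1 c) ((fun y => t y 0 d) \o rsubmx) x).
    by congr (pderiv _ _ x); apply/funext => y; rewrite row_mxEr.
  by rewrite pderiv_rr.
Qed.

End BlockCalculus.

Section Manifold.
Variables (R : realType) (n : nat).

(* A smooth n-manifold, given by an atlas indexed by [index] (not required to
   be maximal).  [chart i] is only meaningful on [cdom i], and [param i], its
   inverse, on [cimg i]. *)
Record manifold := Manifold {
  carrier :> topologicalType;
  index : Type;
  cdom : index -> set carrier;
  cimg : index -> set 'rV[R]_n;
  chart : index -> carrier -> 'rV[R]_n;
  param : index -> 'rV[R]_n -> carrier;
  mfd_hausdorff : hausdorff_space carrier;
  mfd_countable : @second_countable carrier;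
  mfd_cover : forall p, exists i, cdom i p;
  cdom_open : forall i, open (cdom i);
  cimg_open : forall i, open (cimg i);
  chart_img : forall i p, cdom i p -> cimg i (chart i p);
  param_dom : forall i x, cimg i x -> cdom i (param i x);
  chartK : forall i p, cdom i p -> param i (chart i p) = p;
  paramK : forall i x, cimg i x -> chart i (param i x) = x;
  chart_continuous : forall i p, cdom i p -> {for p, continuous (chart i)};
  param_continuous : forall i x, cimg i x -> {for x, continuous (param i)};
  transition_smooth : forall i j (b : 'I_n),
    smooth_on [set x | cimg i x /\ cdom j (param i x)]
              (fun x => chart j (param i x) 0 b)
}.

Variable M : manifold.

Definition overlap (i j : index M) : set 'rV[R]_n :=
  [set x | cimg i x /\ cdom j (param i x)].

Definition transition (i j : index M) : 'rV[R]_n -> 'rV[R]_n :=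
  fun x => chart j (param i x).

Record smooth_fun := SmoothFun {
  sfun :> M -> R;
  sfun_smooth : forall i : index M,
    smooth_on (cimg i) (fun x => sfun (param i x))
}.

Record pos_smooth_fun := PosSmoothFun {
  psfun :> smooth_fun;
  psfun_gt0 : forall p, 0 < psfun p
}.

(* The components of a covariant 2-tensor field in each chart, as functions of
   the coordinates; the value off [cimg i] is irrelevant. *)
Definition tensor2 := index M -> 'rV[R]_n -> 'M[R]_n.

Definition tensor_eq (S T : tensor2) : Prop :=
  forall i x, cimg i x -> S i x = T i x.

(* Only nondegeneracy is required: the index of the metric is then locally
   constant, hence constant on a connected manifold. *)
Record pseudo_metric := PseudoMetric {
  mcomp : index M -> 'rV[R]_n -> 'M[R]_n;
  mcomp_smooth : forall i a b, smooth_on (cimg i) (fun x => mcomp i x a b);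
  mcomp_sym : forall i x, cimg i x -> (mcomp i x)^T = mcomp i x;
  mcomp_nondeg : forall i x, cimg i x -> mcomp i x \in unitmx;
  mcomp_transform : forall i j x, overlap i j x ->
    mcomp i x = jac (transition i j) x *m mcomp j (transition i j x)
                  *m (jac (transition i j) x)^T
}.

End Manifold.

Coercion mcomp : pseudo_metric >-> Funclass.

Section Curvature.
Variables (R : realType) (n : nat) (M : manifold R n) (g : pseudo_metric M).
Variable i : index M.
Implicit Types (x : 'rV[R]_n) (a b c d e : 'I_n).

(* Gamma^e_(a b) of the Levi-Civita connection. *)
Definition christoffel e a b x : R :=
  2^-1 * \sum_d invmx (g i x) e d *
    (pderiv a (fun y => g i y d b) x + pderiv b (fun y => g i y d a) x
     - pderiv d (fun y => g i y a b) x).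

(* dx^d (R(d_a, d_b) d_c) for the coordinate frame (d_a),
   with R(X, Y) = [nabla_X, nabla_Y] - nabla_[X, Y]. *)
Definition riemann d c a b x : R :=
  pderiv a (christoffel d b c) x - pderiv b (christoffel d a c) x
  + \sum_e (christoffel d a e x * christoffel e b c x
            - christoffel d b e x * christoffel e a c x).

(* Ric(Y, Z) = tr (X |-> R(X, Y) Z) *)
Definition ricci x : 'M[R]_n := \matrix_(b, c) \sum_a riemann a c a b x.

Definition scalar_curvature x : R :=
  \sum_b \sum_c invmx (g i x) b c * ricci x b c.

(* nabla du *)
Definition hessian (u : M -> R) x : 'M[R]_n :=
  \matrix_(a, b) (pderiv a (pderiv b (fun y => u (param i y))) x
    - \sum_e christoffel e a b x * pderiv e (fun y => u (param i y)) x).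

End Curvature.

Section Solitons.
Variables (R : realType) (n : nat) (M : manifold R n) (g : pseudo_metric M).

Definition einstein_with (mu : R) : Prop :=
  tensor_eq (ricci g) (fun i x => mu *: g i x).

Definition einstein : Prop := exists mu, einstein_with mu.

Definition hessian_conformal (u psi : M -> R) : Prop :=
  tensor_eq (fun i => hessian g i u) (fun i x => psi (param i x) *: g i x).

Definition gradient_almost_RB_soliton (u lambda : M -> R) (rho : R) : Prop :=
  tensor_eq (fun i x => ricci g i x + hessian g i u x)
    (fun i x => (lambda (param i x) + rho * scalar_curvature g i x) *: g i x).

End Solitons.

Section ProductTopology.
Variables S T : topologicalType.

Lemma hausdorff_prod :
  hausdorff_space S -> hausdorff_space T -> hausdorff_space (S * T)%type.
Proof.
move=> hS hT [p1 p2] [q1 q2] pq; congr pair.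
- apply: hS => A B pA qB.
  have [||[z1 z2] [/= Az Bz]] := pq (fst @^-1` A) (fst @^-1` B);
    last by exists z1.
  + by exists (A, setT) => [|z []//]; split=> //; exact: filterT.
  + by exists (B, setT) => [|z []//]; split=> //; exact: filterT.
- apply: hT => A B pA qB.
  have [||[z1 z2] [/= Az Bz]] := pq (snd @^-1` A) (snd @^-1` B);
    last by exists z2.
  + by exists (setT, A) => [|z []//]; split=> //; exact: filterT.
  + by exists (setT, B) => [|z []//]; split=> //; exact: filterT.
Qed.

Lemma open_setX (A : set S) (B : set T) : open A -> open B -> open (A `*` B).
Proof.
rewrite !openE => oA oB [p q] [/= Ap Bq].
by exists (A, B) => //; split; [exact: oA|exact: oB].
Qed.

Lemma second_countable_prod : @second_countable S -> @second_countable T ->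
  @second_countable (S * T)%type.
Proof.
move=> [B cB [oB bB]] [C cC [oC bC]].
exists ((fun UV : set S * set T => UV.1 `*` UV.2) @` (B `*` C)).
  by apply: sub_countable (card_image_le _ _) _; exact: countableX.
split=> [_ [[U V] [/= BU CV] <-]|[p q] W [[U V] [/= pU qV] UVW]].
  by apply: open_setX; [exact: oB|exact: oC].
have [U' [BU' U'p] U'U] := bB _ _ pU; have [V' [CV' V'q] V'V] := bC _ _ qV.
exists (U' `*` V'); first by split => //; exists (U', V').
by move=> [x y] [/= /U'U Ux /V'V Vy]; exact: UVW.
Qed.

End ProductTopology.

Section Product.
Variables (R : realType) (n1 n2 : nat).
Variables (M1 : manifold R n1) (M2 : manifold R n2).
Local Notation N := (n1 + n2)%N.
Local Notation carrierP := (carrier M1 * carrier M2)%type.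
Local Notation indexP := (index M1 * index M2)%type.

Let cdomP (i : indexP) : set carrierP := cdom i.1 `*` cdom i.2.
Let cimgP (i : indexP) : set 'rV[R]_N :=
  [set x | cimg i.1 (lsubmx x) /\ cimg i.2 (rsubmx x)].
Let chartP (i : indexP) (p : carrierP) : 'rV[R]_N :=
  row_mx (chart i.1 p.1) (chart i.2 p.2).
Let paramP (i : indexP) (x : 'rV[R]_N) : carrierP :=
  (param i.1 (lsubmx x), param i.2 (rsubmx x)).

Lemma prod_cover p : exists i, cdomP i p.
Proof.
have [i ip] := mfd_cover p.1; have [j jp] := mfd_cover p.2.
by exists (i, j).
Qed.

Lemma prod_cdom_open i : open (cdomP i).
Proof. by apply: open_setX; exact: cdom_open. Qed.

Lemma prod_cimg_open i : open (cimgP i).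
Proof.
apply: openI.
- apply: open_comp; last exact: cimg_open.
  by move=> x _; exact: continuous_lsubmx.
- apply: open_comp; last exact: cimg_open.
  by move=> x _; exact: continuous_rsubmx.
Qed.

Lemma prod_chart_img i p : cdomP i p -> cimgP i (chartP i p).
Proof.
by move=> [p1 p2]; rewrite /cimgP /= row_mxKl row_mxKr; split; exact: chart_img.
Qed.

Lemma prod_param_dom i x : cimgP i x -> cdomP i (paramP i x).
Proof. by move=> [x1 x2]; split; exact: param_dom. Qed.

Lemma prod_chartK i p : cdomP i p -> paramP i (chartP i p) = p.
Proof.
move=> [p1 p2]; rewrite /paramP row_mxKl row_mxKr !chartK //.
by case: p {p1 p2}.
Qed.

Lemma prod_paramK i x : cimgP i x -> chartP i (paramP i x) = x.
Proof. by move=> [x1 x2]; rewrite /chartP !paramK //= hsubmxK. Qed.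

Lemma prod_chart_continuous i p : cdomP i p -> {for p, continuous (chartP i)}.
Proof.
move=> [p1 p2] W [P nP PW].
have /(chart_continuous p1) A : nbhs (chart i.1 p.1)
    [set y | forall a b, P a (lshift n2 b) (y a b)].
  exists (fun a b => P a (lshift n2 b)) => // a b.
  by have := nP a (lshift n2 b); rewrite /chartP row_mxEl.
have /(chart_continuous p2) B : nbhs (chart i.2 p.2)
    [set y | forall a b, P a (rshift n1 b) (y a b)].
  exists (fun a b => P a (rshift n1 b)) => // a b.
  by have := nP a (rshift n1 b); rewrite /chartP row_mxEr.
eexists (_, _); first by split; [exact: A|exact: B].
move=> [q1 q2] [/= q1P q2P]; apply: PW => a b.
by case: (split_ordP b) => c ->; rewrite ?(row_mxEl, row_mxEr).
Qed.

Lemma prod_param_continuous i x : cimgP i x -> {for x, continuous (paramP i)}.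
Proof.
move=> [x1 x2].
have c1 : {for x, continuous (param i.1 \o lsubmx)}.
  by apply: continuous_comp; [exact: continuous_lsubmx|exact: param_continuous].
have c2 : {for x, continuous (param i.2 \o rsubmx)}.
  by apply: continuous_comp; [exact: continuous_rsubmx|exact: param_continuous].
exact: (cvg_pair c1 c2).
Qed.

Lemma prod_transition_smooth i j (b : 'I_N) :
  smooth_on [set x | cimgP i x /\ cdomP j (paramP i x)]
            (fun x => chartP j (paramP i x) 0 b).
Proof.
case: (split_ordP b) => c -> k.
- have := smooth_lsubmx n2 (@transition_smooth _ _ M1 i.1 j.1 c) k.
  move/(CkS (V := [set x | cimgP i x /\ cdomP j (paramP i x)])) => H.
  have -> : (fun x => chartP j (paramP i x) 0 (lshift n2 c)) =
      (fun y => chart j.1 (param i.1 y) 0 c) \o lsubmx.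
    by apply/funext => x; rewrite /chartP row_mxEl.
  apply: H => x [[x1 _] [d1 _]]; by split.
- have := smooth_rsubmx n1 (@transition_smooth _ _ M2 i.2 j.2 c) k.
  move/(CkS (V := [set x | cimgP i x /\ cdomP j (paramP i x)])) => H.
  have -> : (fun x => chartP j (paramP i x) 0 (rshift n1 c)) =
      (fun y => chart j.2 (param i.2 y) 0 c) \o rsubmx.
    by apply/funext => x; rewrite /chartP row_mxEr.
  apply: H => x [[_ x2] [_ d2]]; by split.
Qed.

Definition prod_manifold : manifold R N :=
  @Manifold R N carrierP indexP cdomP cimgP chartP paramP
    (hausdorff_prod (@mfd_hausdorff _ _ M1) (@mfd_hausdorff _ _ M2))
    (second_countable_prod (@mfd_countable _ _ M1) (@mfd_countable _ _ M2))
    prod_cover prod_cdom_open prod_cimg_open prod_chart_img prod_param_dom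
    prod_chartK prod_paramK prod_chart_continuous prod_param_continuous
    prod_transition_smooth.

End Product.

Section Conformal.
Variables (R : realType) (n : nat) (M : manifold R n).
Variables (phi : pos_smooth_fun M) (g : pseudo_metric M).

Let comp (i : index M) (x : 'rV[R]_n) : 'M[R]_n :=
  phi (param i x) ^+ 2 *: g i x.

Lemma conformal_smooth i a b : smooth_on (cimg i) (fun x => comp i x a b).
Proof.
move=> k; have := @cimg_open _ _ M i => oi.
have Cphi := @sfun_smooth _ _ _ phi i k.
have := Ck_mul oi (Ck_mul oi Cphi Cphi) (@mcomp_smooth _ _ _ g i a b k).
by apply: Ck_eq => // x _; rewrite /comp mxE expr2.
Qed.

Lemma conformal_sym i x : cimg i x -> (comp i x)^T = comp i x.
Proof. by move=> ix; rewrite /comp linearZ /= mcomp_sym. Qed.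

Lemma conformal_nondeg i x : cimg i x -> comp i x \in unitmx.
Proof.
move=> ix; rewrite /comp unitmxZ ?mcomp_nondeg //.
by rewrite unitfE expf_eq0 /= gt_eqF // psfun_gt0.
Qed.

Lemma conformal_transform i j x : overlap i j x ->
  comp i x = jac (transition i j) x *m comp j (transition i j x)
               *m (jac (transition i j) x)^T.
Proof.
move=> ov; have [_ dj] := ov; rewrite /comp (mcomp_transform g ov).
by rewrite -scalemxAr -scalemxAl /transition chartK.
Qed.

Definition conformal_metric : pseudo_metric M :=
  PseudoMetric conformal_smooth conformal_sym conformal_nondeg
    conformal_transform.

End Conformal.

Section Twisted.
Variables (R : realType) (n1 n2 : nat).
Variables (M1 : manifold R n1) (M2 : manifold R n2).
Variables (g1 : pseudo_metric M1) (g2 : pseudo_metric M2).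
Local Notation M := (prod_manifold M1 M2).
Local Notation N := (n1 + n2)%N.
Variable f : pos_smooth_fun M.

Let comp (i : index M) (x : 'rV[R]_N) : 'M[R]_N :=
  block_mx (g1 i.1 (lsubmx x)) 0
           0 (f (param i x) ^+ 2 *: g2 i.2 (rsubmx x)).

Lemma twisted_smooth i a b : smooth_on (cimg i) (fun x => comp i x a b).
Proof.
move=> k; rewrite /comp.
case: (split_ordP a) => c ->; case: (split_ordP b) => d ->.
- under eq_fun do rewrite block_mxEul.
  have := smooth_lsubmx n2 (@mcomp_smooth _ _ _ g1 i.1 c d) k.
  by apply: CkS => x [].
- by under eq_fun do rewrite block_mxEur mxE; exact: smooth_cst.
- by under eq_fun do rewrite block_mxEdl mxE; exact: smooth_cst.
- under eq_fun do rewrite block_mxEdr mxE expr2.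
  have oi := @cimg_open _ _ M i; have Cf := @sfun_smooth _ _ _ f i k.
  apply: Ck_mul (Ck_mul oi Cf Cf) _ => //.
  have := smooth_rsubmx n1 (@mcomp_smooth _ _ _ g2 i.2 c d) k.
  by apply: CkS => x [].
Qed.

Lemma twisted_sym i x : cimg i x -> (comp i x)^T = comp i x.
Proof.
by move=> [x1 x2]; rewrite /comp tr_block_mx !trmx0 linearZ /= !mcomp_sym //.
Qed.

Lemma twisted_nondeg i x : cimg i x -> comp i x \in unitmx.
Proof.
move=> [x1 x2]; rewrite unitmxE det_ublock unitrM -!unitmxE mcomp_nondeg //=.
by rewrite unitmxZ ?mcomp_nondeg // unitfE expf_eq0 /= gt_eqF // psfun_gt0.
Qed.

Lemma twisted_transform i j x : overlap i j x ->
  comp i x = jac (transition i j) x *m comp j (transition i j x)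
               *m (jac (transition i j) x)^T.
Proof.
move=> [[x1 x2] [d1 d2]].
have -> : jac (transition i j) x =
    block_mx (jac (transition i.1 j.1) (lsubmx x)) 0
             0 (jac (transition i.2 j.2) (rsubmx x)).
  exact: (jac_block (transition i.1 j.1) (transition i.2 j.2)).
rewrite /comp tr_block_mx !trmx0 !mulmx_block !(mul0mx, mulmx0, addr0, add0r).
congr block_mx.
- by rewrite /transition /= row_mxKl; exact: mcomp_transform.
- have -> : param j (transition i j x) = param i x by exact: (@chartK _ _ M).
  rewrite -scalemxAr -scalemxAl /transition /= row_mxKr; congr (_ *: _).
  exact: mcomp_transform.
Qed.

Definition twisted_metric : pseudo_metric M :=
  PseudoMetric twisted_smooth twisted_sym twisted_nondeg twisted_transform.

Definition lyra_twisted_metric (phi : pos_smooth_fun M) : pseudo_metric M :=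
  conformal_metric phi twisted_metric.

End Twisted.

(* Main.v *)
(* A connection on a chart is a family of matrices A_a over the ring of smooth
   functions, with commuting derivations D_a, and R_ab = D_a A_b - D_b A_a
   + [A_a, A_b]; the second Bianchi identity and its contraction are then
   identities over a commutative ring with derivations.

   If Hess u = psi g, the soliton equation makes Ric pointwise proportional to
   g, Ric = s g, and contracting the second Bianchi identity twice gives
   (n - 2) D_e s = 0: s is locally constant in each chart.  By naturality of the
   Ricci tensor under coordinate changes (Levi-Civita connections correspond,
   by uniqueness of the torsion-free metric connection) the functions s of
   different charts agree, so s is constant on the connected manifold.
   Conversely, if Ric = mu g, then R = n mu and the soliton equation reads
   Hess u = (lambda + rho n mu - mu) g. *)

Require Import Defs.
From HB Require Import structures.
From mathcomp Require Import all_boot all_order all_algebra ring lra.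
From mathcomp Require Import all_classical all_reals all_analysis.
Set Implicit Arguments.
Unset Strict Implicit.
Unset Printing Implicit Defensive.
Import Order.TTheory GRing.Theory Num.Theory.
Import numFieldNormedType.Exports.
Local Open Scope classical_set_scope.
Local Open Scope ring_scope.

(** * Connections over a ring with commuting derivations *)

Lemma mxDE (K : pzRingType) m n (A B : 'M[K]_(m, n)) i j :
  (A + B) i j = A i j + B i j.
Proof. by rewrite mxE. Qed.

Lemma mxNE (K : pzRingType) m n (A : 'M[K]_(m, n)) i j : (- A) i j = - A i j.
Proof. by rewrite mxE. Qed.

Lemma mxE0 (K : pzRingType) m n i j : (0 : 'M[K]_(m, n)) i j = 0.
Proof. by rewrite mxE. Qed.

Lemma mxDT (K : pzRingType) m n (A B : 'M[K]_(m, n)) : (A + B)^T = A^T + B^T.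
Proof. by apply/matrixP => i j; rewrite !mxE. Qed.

Lemma mxNT (K : pzRingType) m n (A : 'M[K]_(m, n)) : (- A)^T = - A^T.
Proof. by apply/matrixP => i j; rewrite !mxE. Qed.

Lemma mxZT (K : pzRingType) m n a (A : 'M[K]_(m, n)) : (a *: A)^T = a *: A^T.
Proof. by apply/matrixP => i j; rewrite !mxE. Qed.

(* [ring] needs a commutative ring: entrywise, a matrix identity becomes linear
   in the entries of the (noncommutative) products, which are generalized. *)
Ltac mx_abelian :=
  let i := fresh in let j := fresh in
  apply/matrixP => i j; rewrite ?(mxDE, mxNE, mxE0);
  repeat match goal with |- context [fun_of_matrix ?A i j] =>
    move: (fun_of_matrix A i j) => ? end;
  ring.

Ltac mx_noncomm :=
  rewrite ?(mulmxDl, mulmxDr, mulmxN, mulNmx, opprD, opprK, mulmxA); mx_abelian.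

Section Frame.
Variables (K : comPzRingType) (n : nat).

(** Models the coordinate derivations of the smooth functions on a chart; [fderC] is the symmetry of
    second partial derivatives. *)
Record frame := Frame {
  fder :> 'I_n -> K -> K;
  fderD : forall a x y, fder a (x + y) = fder a x + fder a y;
  fderM : forall a x y, fder a (x * y) = fder a x * y + x * fder a y;
  fderC : forall a b x, fder a (fder b x) = fder b (fder a x)
}.

Variable D : frame.

Lemma fder0 a : D a 0 = 0.
Proof. by apply: (addrI (D a 0)); rewrite -fderD !addr0. Qed.

Lemma fder1 a : D a 1 = 0.
Proof.
by apply: (addrI (D a 1)); rewrite addr0 -{3}(mulr1 1) fderM mulr1 mul1r.
Qed.

Lemma fderN a x : D a (- x) = - D a x.
Proof. by apply: (addrI (D a x)); rewrite -fderD !subrr fder0. Qed.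

Lemma fder_sum a I (r : seq I) (P : pred I) F :
  D a (\sum_(i <- r | P i) F i) = \sum_(i <- r | P i) D a (F i).
Proof. exact: (big_morph _ (fderD D a) (fder0 a)). Qed.

Definition dmx p q a (A : 'M[K]_(p, q)) := map_mx (D a) A.

Lemma dmxD p q a (A B : 'M[K]_(p, q)) : dmx a (A + B) = dmx a A + dmx a B.
Proof. by apply/matrixP => i j; rewrite !mxE fderD. Qed.

Lemma dmxN p q a (A : 'M[K]_(p, q)) : dmx a (- A) = - dmx a A.
Proof. by apply/matrixP => i j; rewrite !mxE fderN. Qed.

Lemma dmxM p q r a (A : 'M[K]_(p, q)) (B : 'M[K]_(q, r)) :
  dmx a (A *m B) = dmx a A *m B + A *m dmx a B.
Proof.
apply/matrixP => i j; rewrite !mxE fder_sum -big_split /=.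
by apply: eq_bigr => k _; rewrite fderM !mxE.
Qed.

Lemma dmxT p q a (A : 'M[K]_(p, q)) : dmx a A^T = (dmx a A)^T.
Proof. by apply/matrixP => i j; rewrite !mxE. Qed.

Lemma dmxC p q a b (A : 'M[K]_(p, q)) : dmx a (dmx b A) = dmx b (dmx a A).
Proof. by apply/matrixP => i j; rewrite !mxE fderC. Qed.

Lemma dmx1 p a : dmx a (1%:M : 'M[K]_p) = 0.
Proof.
by apply/matrixP => i j; rewrite !mxE; case: eqP; rewrite ?fder1 ?fder0.
Qed.

(* [A a] is the matrix of the a-th covariant derivative minus [D a], and
   [curv A a b] that of R(d_a, d_b); row indices are the upper ones. *)
Implicit Types (A : 'I_n -> 'M[K]_n) (G H : 'M[K]_n).

Definition curv A a b : 'M[K]_n :=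
  dmx a (A b) - dmx b (A a) + A a *m A b - A b *m A a.

Definition ric A : 'M[K]_n := \matrix_(b, c) \sum_a curv A a b a c.

Definition torsion_free A := forall e a b, A a e b = A b e a.

Definition metric_conn G A := forall a, dmx a G = G *m A a + (A a)^T *m G.

Lemma curv_entry A a b d c : curv A a b d c = D a (A b d c) - D b (A a d c)
  + \sum_e (A a d e * A b e c - A b d e * A a e c).
Proof. by rewrite !mxE -addrA sumrB. Qed.

Lemma curvC A a b : curv A b a = - curv A a b.
Proof. rewrite /curv; mx_noncomm. Qed.

(** The derivations [D a] and [D b] commute on [G]; expanding both orders with [metric_conn], their
    difference is exactly [G *m curv A a b] plus its transpose. *)
Lemma curv_skew G A a b : metric_conn G A -> G^T = G ->
  G *m curv A a b = - (G *m curv A a b)^T.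
Proof.
move=> mA GT; apply/eqP; rewrite -addr_eq0; apply/eqP.
have := dmxC a b G; rewrite !mA !dmxD !dmxM !mA !dmxT.
rewrite /curv trmx_mul GT !(mxDT, mxNT) !trmx_mul => /eqP.
rewrite -subr_eq0 => /eqP <-; mx_noncomm.
Qed.

(** Covariant derivative along [e] of [curv A a b] as an endomorphism: the connection acts by a
    commutator, and the form indices [a], [b] are held fixed. *)
Definition ncurv A e a b : 'M[K]_n :=
  dmx e (curv A a b) + A e *m curv A a b - curv A a b *m A e.

(** Second derivatives of [A] cancel by [dmxC], terms with one derivative by the Leibniz rule, and
    cubic terms by the Jacobi identity. *)
Lemma bianchi2 A e a b : ncurv A e a b + ncurv A a b e + ncurv A b e a = 0.
Proof.
rewrite /ncurv /curv !(dmxD, dmxN, dmxM).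
by rewrite (dmxC a e) (dmxC b e) (dmxC b a); mx_noncomm.
Qed.


(** The full covariant derivative: the two sums are the connection terms of the form indices [a] and
    [b], which [ncurv] omits. *)
Definition covcurv A e a b : 'M[K]_n :=
  ncurv A e a b - \sum_k A e k a *: curv A k b - \sum_k A e k b *: curv A a k.

Lemma covcurvC A e a b : covcurv A e b a = - covcurv A e a b.
Proof.
rewrite /covcurv /ncurv (curvC A a b) dmxN.
have sumC u v : \sum_k A e k u *: curv A v k = - \sum_k A e k u *: curv A k v.
  by rewrite -sumrN; apply: eq_bigr => k _; rewrite (curvC A k v) scalerN.
rewrite (sumC b a) (sumC a b); mx_noncomm.
Qed.

(** In the cyclic sum, torsion-freeness and the antisymmetry of [curv] cancel the added connection
    terms in pairs, which leaves [bianchi2]. *)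
Lemma covcurv_bianchi2 A e a b : torsion_free A ->
  covcurv A e a b + covcurv A a b e + covcurv A b e a = 0.
Proof.
move=> tA; have := bianchi2 A e a b; rewrite /covcurv.
have sumC u v w : \sum_k A u k v *: curv A w k = - \sum_k A v k u *: curv A k w.
  rewrite -sumrN; apply: eq_bigr => k _.
  by rewrite (curvC A k w) scalerN tA.
rewrite (sumC e b a) (sumC a e b) (sumC b a e) => <-; mx_abelian.
Qed.

(** Contraction commutes with covariant differentiation: the connection terms on the contracted pair
    cancel, and the covariant derivative of [ric A] remains. *)
Lemma covcurv_trace A e b c :
  \sum_a covcurv A e a b a c =
  (dmx e (ric A) - (A e)^T *m ric A - ric A *m A e) b c.
Proof.
have E a : covcurv A e a b a c = D e (curv A a b a c)
    + \sum_k A e a k * curv A a b k c - \sum_k curv A a b a k * A e k c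
    - \sum_k A e k a * curv A k b a c - \sum_k A e k b * curv A a k a c.
  rewrite /covcurv /ncurv !mxE !summxE.
  by congr (_ - _ - _); apply: eq_bigr => k _; rewrite mxE.
rewrite (eq_bigr _ (fun a _ => E a)) !(sumrB, big_split) /=.
rewrite [X in _ + _ - _ - X - _]exchange_big /= !mxE fder_sum.
rewrite [X in _ + _ - X - _ - _]exchange_big [X in _ - X]exchange_big /=.
have -> : \sum_k \sum_a curv A a b a k * A e k c
    = \sum_k ric A b k * A e k c.
  by apply: eq_bigr => k _; rewrite mxE mulr_suml.
have -> : \sum_k \sum_a A e k b * curv A a k a c
    = \sum_k (A e)^T b k * ric A k c.
  by apply: eq_bigr => k _; rewrite !mxE mulr_sumr.
ring.
Qed.

(** * The twice contracted second Bianchi identity *)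

Section Schur.
Variables (G H : 'M[K]_n) (A : 'I_n -> 'M[K]_n) (s : K).
Hypotheses (GT : G^T = G) (GH : G *m H = 1%:M).
Hypotheses (tA : torsion_free A) (mA : metric_conn G A).
Hypothesis ricA : ric A = s *: G.

Let HG : H *m G = 1%:M. Proof. exact: mulmx1C. Qed.

Let HT : H^T = H.
Proof.
by rewrite -[RHS]mul1mx -(trmx1 K n) -GH trmx_mul GT -mulmxA GH mulmx1.
Qed.

(** Differentiating [G *m H = 1] shows that the inverse metric is parallel too, so raising an index
    commutes with covariant differentiation. *)
Lemma dmx_inv_metric a : dmx a H = - (A a *m H) - H *m (A a)^T.
Proof.
have : H *m dmx a (G *m H) = 0 by rewrite GH dmx1 mulmx0.
rewrite dmxM mA !mulmxDl !mulmxDr !mulmxA HG !mul1mx.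
rewrite -(mulmxA (H *m _)) GH mulmx1.
by rewrite addrC => /eqP; rewrite addr_eq0 opprD => /eqP.
Qed.

(** The curvature with its column index raised; skewness with respect to [G] becomes plain
    antisymmetry of this matrix. *)
Let S b e := curv A b e *m H.

Let S_skew b e : (S b e)^T = - S b e.
Proof.
have := curv_skew b e mA GT => /(congr1 (fun X => H *m X *m H)).
rewrite !mulmxA HG mul1mx mulmxN mulNmx trmx_mul GT !mulmxA -(mulmxA _ G H) GH.
by rewrite mulmx1 /S trmx_mul HT => ->; rewrite opprK.
Qed.

(** Antisymmetry of [S] turns this trace into minus the one that defines Ricci, and Ricci with an
    index raised is [s] times the identity. *)
Let V_scalar a e : \sum_b S b e a b = - s * (a == e)%:R.
Proof.
have -> : \sum_b S b e a b = - \sum_b S b e b a.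
  rewrite -sumrN; apply: eq_bigr => b _.
  by rewrite -[in LHS](trmxK (S b e)) mxE S_skew mxNE.
have -> : \sum_b S b e b a = (ric A *m H) e a.
  rewrite mxE; under [RHS]eq_bigr do rewrite mxE mulr_suml.
  by rewrite exchange_big; apply: eq_bigr => b _; rewrite mxE.
by rewrite ricA -scalemxAl GH !mxE eq_sym mulNr.
Qed.

(** As [H] is parallel, contracting first over [b] leaves the divergence of [- s] times the
    identity, whose connection terms cancel. *)
Let covcurv_div e :
  \sum_a \sum_b (covcurv A a b e *m H) a b = - D e s.
Proof.
have E a b : (covcurv A a b e *m H) a b = D a (S b e a b)
    + \sum_k A a a k * S b e k b + \sum_k S b e a k * A a b k
    - \sum_k A a k b * S k e a b - \sum_k A a k e * S b k a b.
  have -> : covcurv A a b e *m H =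
      dmx a (S b e) + A a *m S b e + S b e *m (A a)^T
      - \sum_k A a k b *: S k e - \sum_k A a k e *: S b k.
    rewrite /covcurv /ncurv !mulmxBl !mulmx_suml.
    congr (_ - _ - _); last 2 first.
    - by apply: eq_bigr => k _; rewrite -scalemxAl.
    - by apply: eq_bigr => k _; rewrite -scalemxAl.
    rewrite /S dmxM dmx_inv_metric; mx_noncomm.
  rewrite !(mxDE, mxNE) !summxE; congr (_ + _ + _ - _ - _).
  - by rewrite mxE.
  - by rewrite mxE.
  - by rewrite mxE; apply: eq_bigr => k _; congr (_ * _); rewrite mxE.
  - by apply: eq_bigr => k _; rewrite mxE.
  - by apply: eq_bigr => k _; rewrite mxE.
(* The connection terms on the contracted index [b] cancel here; those on [a] and on [e] cancel each
   other only in the outer sum. *)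
have inner a : \sum_b (covcurv A a b e *m H) a b =
    D a (- s * (a == e)%:R) - \sum_k A a a k * (s * (k == e)%:R)
      + \sum_k A a k e * (s * (a == k)%:R).
  rewrite (eq_bigr _ (fun b _ => E a b)) !(sumrB, big_split) /=.
  rewrite -fder_sum V_scalar.
  rewrite [X in _ + X - _ - _]exchange_big /=.
  rewrite [X in _ + X + _ - _ - _]exchange_big [X in _ - X = _]exchange_big /=.
  have -> : \sum_k \sum_b A a a k * S b e k b
      = - \sum_k A a a k * (s * (k == e)%:R).
    rewrite -sumrN; apply: eq_bigr => k _.
    by rewrite -mulr_sumr V_scalar; ring.
  have -> : \sum_k \sum_b A a k e * S b k a b
      = - \sum_k A a k e * (s * (a == k)%:R).
    rewrite -sumrN; apply: eq_bigr => k _.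
    by rewrite -mulr_sumr V_scalar; ring.
  under [X in _ + X - _ + _]eq_bigr do under eq_bigr do rewrite mulrC.
  ring.
rewrite (eq_bigr _ (fun a _ => inner a)) big_split sumrB /=.
rewrite [X in _ - X + _]exchange_big /= -[RHS](addrNK (\sum_a A a a e * s)).
congr (_ + _); last first.
  apply: eq_bigr => a _; rewrite (bigD1 a) //= eqxx mulr1 big1 ?addr0 // => k.
  by rewrite eq_sym => /negbTE ->; rewrite !mulr0.
congr (_ - _).
  rewrite (bigD1 e) //= eqxx mulr1 fderN big1 ?addr0 // => a /negbTE ->.
  by rewrite mulr0 fder0.
rewrite (bigD1 e) //= [X in _ + X]big1 ?addr0 => [|k /negbTE ke].
  by apply: eq_bigr => a _; rewrite eqxx mulr1.
by rewrite big1 // => a _; rewrite ke !mulr0.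
Qed.

(** The three terms of the cyclic Bianchi sum contract to [n], -1 and -1 times [D e s]. Nothing is
    divided by [n - 2], since [K] is only a commutative ring. *)
Lemma schur_identity e : D e s *+ n = D e s *+ 2.
Proof.
(* Since [G] is parallel, the covariant derivative of [s *: G] only differentiates [s]. *)
have cRic a b c : \sum_d covcurv A a d b d c = D a s * G b c.
  rewrite covcurv_trace ricA.
  have -> : dmx a (s *: G) = D a s *: G + s *: dmx a G.
    by apply/matrixP => i j; rewrite !mxE fderM.
  rewrite mA -scalemxAl -scalemxAr !(mxDE, mxNE) !mxE; ring.
have sum3 (X Y Z : 'I_n -> 'I_n -> 'M[K]_n) :
    \sum_a \sum_b ((X a b + Y a b + Z a b) *m H) a b =
    \sum_a \sum_b (X a b *m H) a b + \sum_a \sum_b (Y a b *m H) a b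
    + \sum_a \sum_b (Z a b *m H) a b.
  rewrite -!big_split; apply: eq_bigr => a _.
  by rewrite -!big_split; apply: eq_bigr => b _; rewrite !mulmxDl !mxDE.
have : \sum_a \sum_b ((covcurv A e a b + covcurv A a b e + covcurv A b e a)
                        *m H) a b = 0.
  apply: big1 => a _; apply: big1 => b _.
  by rewrite covcurv_bianchi2 // mul0mx mxE.
rewrite sum3 covcurv_div.
have -> : \sum_a \sum_b (covcurv A e a b *m H) a b = D e s *+ n.
  rewrite exchange_big /=.
  transitivity (\sum_b (D e s * (G *m H) b b)).
    apply: eq_bigr => b _; under eq_bigr do rewrite mxE.
    rewrite exchange_big mxE mulr_sumr; apply: eq_bigr => c _.
    by rewrite -mulr_suml cRic mulrA.
  rewrite GH (eq_bigr (fun=> D e s)) ?sumr_const ?card_ord // => b _.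
  by rewrite !mxE eqxx mulr1.
have -> : \sum_a \sum_b (covcurv A b e a *m H) a b = - D e s.
  rewrite exchange_big /=.
  transitivity (\sum_b (- D b s * (G *m H) e b)).
    apply: eq_bigr => b _; under eq_bigr do rewrite mxE.
    rewrite exchange_big mxE mulr_sumr; apply: eq_bigr => c _.
    rewrite -mulr_suml mulrA mulNr; congr (_ * _).
    by rewrite -cRic -sumrN; apply: eq_bigr => d _; rewrite covcurvC mxNE.
  rewrite GH (bigD1 e) //= big1 ?addr0 => [|b /negbTE be].
    by rewrite mxE eqxx mulr1.
  by rewrite mxE eq_sym be mulr0.
by move=> /eqP; rewrite -addrA -opprD subr_eq0 => /eqP ->; rewrite mulr2n.
Qed.

End Schur.

(** * Existence and uniqueness of the Levi-Civita connection *)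

Section LeviCivita.
Variables (G H : 'M[K]_n) (h : K).
Hypotheses (GT : G^T = G) (GH : G *m H = 1%:M) (h2 : h + h = 1).

(** The difference of the connections, lowered by [G], is symmetric in one pair of indices and skew
    in another; such a tensor vanishes once 2 is invertible, with inverse [h]. *)
Lemma metric_conn_unique A B : torsion_free A -> metric_conn G A ->
  torsion_free B -> metric_conn G B -> forall a, A a = B a.
Proof.
move=> tA mA tB mB.
have HG : H *m G = 1%:M by exact: mulmx1C.
pose y f a b := (G *m (A a - B a)) f b.
have y_sym f a b : y f a b = y f b a.
  rewrite /y !mxE; apply: eq_bigr => k _.
  by congr (_ * _); rewrite !mxE tA tB.
have y_skew f a b : y f a b = - y b a f.
  have : G *m (A a - B a) + (A a - B a)^T *m G = 0.
    have /eqP := mB a; rewrite mA -subr_eq0 => /eqP <-.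
    rewrite mxDT mxNT; mx_noncomm.
  rewrite -{2}GT -trmx_mul => /matrixP /(_ f b).
  by rewrite mxDE [X in _ + X]mxE mxE0 => /eqP; rewrite addr_eq0 => /eqP.
have y0 f a b : y f a b = 0.
  (* Alternating the two symmetries three times restores the indices with three sign changes. *)
  have yN : y f a b = - y f a b.
    by rewrite {1}y_skew y_sym y_skew y_sym y_skew y_sym opprK.
  by rewrite -[LHS]mul1r -h2 mulrDl {1}yN mulrN addNr.
move=> a; apply/eqP; rewrite -subr_eq0; apply/eqP.
rewrite -[LHS]mul1mx -HG -mulmxA.
have -> : G *m (A a - B a) = 0.
  by apply/matrixP => f b; rewrite mxE0 -(y0 f a b).
by rewrite mulmx0.
Qed.

Definition levi_civita a : 'M[K]_n := \matrix_(e, b)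
  (h * \sum_d H e d * (D a (G d b) + D b (G d a) - D d (G a b))).

Let GE a b : G a b = G b a. Proof. by rewrite -{1}GT mxE. Qed.

Lemma levi_civita_torsion_free : torsion_free levi_civita.
Proof.
move=> e a b; rewrite !mxE; congr (_ * _); apply: eq_bigr => d _.
by congr (_ * _); rewrite (GE b a); ring.
Qed.

(** With the index lowered by [G], adding the coefficient with its outer indices exchanged doubles
    the derivative along [a] and cancels the others; [h + h = 1] absorbs the factor. *)
Lemma levi_civita_metric : metric_conn G levi_civita.
Proof.
move=> a.
have E f b : (G *m levi_civita a) f b
    = h * (D a (G f b) + D b (G f a) - D f (G a b)).
  transitivity (((h *: (G *m H)) *m
      (\matrix_(d, b) (D a (G d b) + D b (G d a) - D d (G a b)))) f b).
    rewrite -scalemxAl -mulmxA scalemxAr; congr ((_ *m _) _ _).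
    apply/matrixP => i j; rewrite !mxE; congr (_ * _).
    by apply: eq_bigr => d _; rewrite mxE.
  by rewrite GH -scalemxAl mul1mx !mxE.
rewrite -[X in _ = _ + _ *m X]GT -trmx_mul; apply/matrixP => f b.
rewrite mxDE [X in _ + X]mxE !E mxE -[LHS]mul1r -h2.
rewrite (GE a b) (GE b f) (GE a f); ring.
Qed.

End LeviCivita.
End Frame.

(** * Behaviour of connection, curvature and Ricci tensor under a change of coordinates *)

Section Naturality.
Variables (K K' : comPzRingType) (n : nat) (D : frame K n) (D' : frame K' n).
Variables (phi : {rmorphism K' -> K}) (J : 'M[K]_n).
Variables (G H : 'M[K]_n) (G' : 'M[K']_n).
Variables (A : 'I_n -> 'M[K]_n) (A' : 'I_n -> 'M[K']_n) (h : K).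
Hypothesis h2 : h + h = 1.
Hypothesis chain : forall a x, D a (phi x) = \sum_al J a al * phi (D' al x).
Hypothesis J_sym : forall a b al, D a (J b al) = D b (J a al).
Hypothesis GE : G = J *m map_mx phi G' *m J^T.
Hypotheses (GT : G^T = G) (GH : G *m H = 1%:M).
Hypotheses (tA : torsion_free A) (mA : metric_conn D G A).
Hypotheses (tA' : torsion_free A') (mA' : metric_conn D' G' A').

(** The Jacobian is inverted through the metric: by [GE] and [GH] this is a right inverse of [J]. *)
Let JI : 'M[K]_n := map_mx phi G' *m J^T *m H.

Let JK : J *m JI = 1%:M. Proof. by rewrite /JI !mulmxA -GE. Qed.
Let JIK : JI *m J = 1%:M. Proof. exact: mulmx1C. Qed.

(** The pulled-back connection form: only the form index is transformed, the matrix indices stay in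
    the primed frame. [L] below passes from the unprimed to the primed frame. *)
Let B a : 'M[K]_n := \sum_al J a al *: map_mx phi (A' al).

Let dmx_phi p q a (X : 'M[K']_(p, q)) :
  dmx D a (map_mx phi X) = \sum_al J a al *: map_mx phi (dmx D' al X).
Proof.
apply/matrixP => i j; rewrite !mxE chain summxE.
by apply: eq_bigr => al _; rewrite !mxE.
Qed.

Let L := J^T.

Let LK : JI^T *m L = 1%:M. Proof. by rewrite -trmx_mul JK trmx1. Qed.
Let LIK : L *m JI^T = 1%:M. Proof. by rewrite -trmx_mul JIK trmx1. Qed.

Let dmx_metric a : dmx D a (map_mx phi G')
  = map_mx phi G' *m B a + (B a)^T *m map_mx phi G'.
Proof.
rewrite dmx_phi /B mulmx_sumr (raddf_sum (@trmx _ _ _)) mulmx_suml -big_split.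
apply: eq_bigr => al _; rewrite mA' map_mxD !map_mxM scalerDr -map_trmx.
by rewrite /= -scalemxAr mxZT -scalemxAl.
Qed.

(** The pulled-back connection, rewritten in the unprimed frame as [X], is torsion-free and
    compatible with [G]; uniqueness identifies it with [A]. *)
Lemma conn_transform a : dmx D a L = L *m A a - B a *m L.
Proof.
pose X a := JI^T *m (dmx D a L + B a *m L).
have XE c : L *m X c = dmx D c L + B c *m L by rewrite mulmxA LIK mul1mx.
have tX : torsion_free X.
  move=> e c b; rewrite !mxE; apply: eq_bigr => al _; congr (_ * _).
  (* Symmetry of the second derivatives of the coordinate change settles the first summand,
     torsion-freeness of [A'] the second. *)
  rewrite !mxDE; congr (_ + _); first by rewrite !mxE J_sym.
  have BLE u v : (B u *m L) al v
      = \sum_be \sum_ga J u be * phi (A' be al ga) * J v ga.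
    rewrite mxE exchange_big; apply: eq_bigr => ga _.
    rewrite summxE mulr_suml; apply: eq_bigr => be _. by rewrite !mxE.
  rewrite !BLE exchange_big; apply: eq_bigr => be _; apply: eq_bigr => ga _.
  by rewrite tA'; ring.
have mX : metric_conn D G X.
  move=> c; rewrite GE -/L.
  have -> : J = L^T by rewrite trmxK.
  rewrite !dmxM dmxT dmx_metric -!(mulmxA _ L) XE.
  have -> : (X c)^T *m (L^T *m map_mx phi G' *m L)
      = (L *m X c)^T *m map_mx phi G' *m L by rewrite (trmx_mul L) !mulmxA.
  rewrite XE mxDT (trmx_mul (B c)); mx_noncomm.
rewrite (metric_conn_unique GT GH h2 tA mA tX mX) XE; mx_abelian.
Qed.

(** First the curvature of [B] is the pullback of that of [A']; then the change of frame [L]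
    intertwines it with the curvature of [A]. *)
Lemma curv_transform a b : L *m curv D A a b
  = (\sum_al \sum_be (J a al * J b be) *: map_mx phi (curv D' A' al be)) *m L.
Proof.
have curvB : curv D B a b
    = \sum_al \sum_be (J a al * J b be) *: map_mx phi (curv D' A' al be).
  have dB u v : dmx D u (B v) = \sum_be D u (J v be) *: map_mx phi (A' be)
      + \sum_al \sum_be (J u al * J v be) *: map_mx phi (dmx D' al (A' be)).
    rewrite [X in _ + X]exchange_big.
    apply/matrixP => i j; rewrite mxE /B summxE fder_sum mxDE !summxE.
    rewrite -big_split; apply: eq_bigr => be _.
    rewrite !mxE fderM chain mulr_sumr !summxE; congr (_ + _).
    by apply: eq_bigr => al _; rewrite !mxE mulrCA mulrA.
  have BB u v : B u *m B v = \sum_al \sum_be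
      (J u al * J v be) *: map_mx phi (A' al *m A' be).
    rewrite mulmx_suml; apply: eq_bigr => al _.
    rewrite mulmx_sumr; apply: eq_bigr => be _.
    by rewrite map_mxM -scalemxAl -scalemxAr scalerA.
  rewrite /curv !dB !BB.
  have -> : \sum_be D b (J a be) *: map_mx phi (A' be)
      = \sum_be D a (J b be) *: map_mx phi (A' be).
    by apply: eq_bigr => be _; rewrite J_sym.
  rewrite [X in _ - (_ + X)]exchange_big [X in _ + _ - X]exchange_big /=.
  set S1 := \sum_be _; rewrite opprD addrA (addrC S1) addrK.
  rewrite -!sumrB -!big_split -!sumrB; apply: eq_bigr => al _.
  rewrite -!sumrB -!big_split -!sumrB; apply: eq_bigr => be _ /=.
  rewrite !(mulrC (J b be)) !(map_mxB, map_mxD).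
  by rewrite !(scalerBr, scalerDr).
rewrite -curvB; apply/eqP; rewrite -subr_eq0; apply/eqP.
(* The equality of mixed second derivatives of [L], expanded with [conn_transform], is the
   intertwining relation. *)
have /eqP := dmxC D a b L; rewrite !conn_transform !dmxD !dmxN !dmxM.
rewrite !conn_transform -subr_eq0 => /eqP <-; rewrite /curv; mx_noncomm.
Qed.

(** The two traced indices transform by the inverse matrices [JI] and [J], which cancel in the
    trace; a factor [J] stays on each free index. *)
Lemma ric_transform : ric D A = J *m map_mx phi (ric D' A') *m J^T.
Proof.
apply/matrixP => b c; rewrite mxE.
have E a : curv D A a b a c = \sum_al \sum_be \sum_ga \sum_de
    (JI ga a * J a al) * (J b be * phi (curv D' A' al be ga de) * J c de).
  rewrite -[curv _ _ _ _]mul1mx -LK -mulmxA curv_transform.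
  rewrite mulmx_suml mulmx_sumr summxE; apply: eq_bigr => al _.
  rewrite mulmx_suml mulmx_sumr summxE; apply: eq_bigr => be _.
  rewrite mxE; apply: eq_bigr => ga _; rewrite [X in _ * X]mxE mulr_sumr.
  apply: eq_bigr => de _.
  rewrite [JI^T _ _]mxE [L _ _]mxE.
  rewrite [X in _ * (X * _)]mxE [X in _ * (_ * X * _)]mxE.
  ring.
rewrite (eq_bigr _ (fun a _ => E a)).
rewrite exchange_big mxE.
under [RHS]eq_bigr do rewrite mxE mulr_suml.
transitivity (\sum_al \sum_be \sum_de
    J b be * phi (curv D' A' al be al de) * J c de).
  apply: eq_bigr => al _; rewrite exchange_big; apply: eq_bigr => be _.
  rewrite exchange_big (bigD1 al) //= [X in _ + X]big1 ?addr0.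
    rewrite exchange_big; apply: eq_bigr => de _; rewrite -mulr_suml.
    have /matrixP/(_ al al) := JIK; rewrite !mxE eqxx => ->.
    by rewrite mul1r.
  move=> ga /negbTE gaal; rewrite exchange_big big1 // => de _.
  rewrite -mulr_suml; have /matrixP/(_ ga al) := JIK.
  by rewrite !mxE gaal => ->; rewrite mul0r.
rewrite exchange_big [RHS]exchange_big; apply: eq_bigr => be _.
rewrite exchange_big; apply: eq_bigr => de _.
rewrite [X in _ * X * _]mxE [X in phi X]mxE [X in _ = _ * X]mxE.
rewrite rmorph_sum mulr_sumr mulr_suml.
by apply: eq_bigr => al _.
Qed.

End Naturality.

(** * Multivariate calculus *)

Section MeanValue.
Variables (R : realType) (n : nat).
Implicit Types (U : set 'rV[R]_n) (f g : 'rV[R]_n -> R) (v x y h : 'rV[R]_n).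

Lemma row_entry_le_norm v j : `|v 0 j| <= `|v|.
Proof.
rewrite [leRHS]/Num.Def.normr /= mx_normrE.
by apply/bigmax_geP; right => /=; exists (0, j).
Qed.

Lemma row_norm_le v (e : R) : 0 <= e -> (forall j, `|v 0 j| <= e) -> `|v| <= e.
Proof.
move=> e0 ve; rewrite [leLHS]/Num.Def.normr /= mx_normrE.
rewrite bigmax_le // => -[i j] _ /=.
by rewrite ord1.
Qed.

Lemma norm_scale_delta (s : R) a : `|s *: (delta_mx 0 a : 'rV[R]_n)| <= `|s|.
Proof.
apply: row_norm_le => // j; rewrite !mxE eqxx /=.
by case: (j == a); rewrite ?mulr1 // mulr0 normr0.
Qed.

Lemma is_derive_line f v y (t : R) : derivable f (t *: v + y) v ->
  is_derive t 1 (fun s : R => f (s *: v + y)) ('D_v f (t *: v + y)).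
Proof.
have E : (fun s => s^-1 *: (f ((s%:A + t) *: v + y) - f (t *: v + y)))
    = (fun s : R => s^-1 *: (f (s *: v + (t *: v + y)) - f (t *: v + y))).
  by apply/funext => s; rewrite scalerDl addrA [_%:A]mulr1.
move=> df; split; first by rewrite /derivable /= E.
by rewrite /derive /= E.
Qed.

(** The sign of [c] is arbitrary, so the intermediate parameter is located only through its absolute
    value. *)
Lemma mvt_line f v y (c : R) :
  (forall s : R, `|s| <= `|c| -> derivable f (s *: v + y) v) ->
  exists2 s, `|s| <= `|c| &
    f (c *: v + y) - f y = c * 'D_v f (s *: v + y).
Proof.
move=> df; pose g (s : R) := f (s *: v + y).
have dg (t : R) : `|t| <= `|c| -> is_derive t 1 g ('D_v f (t *: v + y)).
  by move=> /df; exact: is_derive_line.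
have g0 : g 0 = f y by rewrite /g scale0r add0r.
rewrite -g0 -/(g c); pose Dg (t : R) := 'D_v f (t *: v + y).
have [c0|c0|->] := ltgtP c 0.
- have le (s : R) : s \in `[c, 0] -> `|s| <= `|c|.
    by rewrite in_itv /= => /andP[cs s0]; rewrite !ler0_norm ?lerN2 // ltW.
  have [||s /subset_itv_oo_cc /le sc E] := @MVT _ g Dg _ _ c0.
  - by move=> s /subset_itv_oo_cc /le; exact: dg.
  - by apply: derivable_within_continuous => s /le /dg [].
  - by exists s => //; rewrite sub0r mulrN in E; rewrite -opprB E opprK mulrC.
- have le (s : R) : s \in `[0, c] -> `|s| <= `|c|.
    by rewrite in_itv /= => /andP[s0 sc]; rewrite !ger0_norm // ltW.
  have [||s /subset_itv_oo_cc /le sc E] := @MVT _ g Dg _ _ c0.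
  - by move=> s /subset_itv_oo_cc /le; exact: dg.
  - by apply: derivable_within_continuous => s /le /dg [].
  - by exists s => //; rewrite E subr0 mulrC.
- by exists 0; rewrite // subrr mul0r.
Qed.

(** Walks from [x] to [h + x] one axis at a time, with the mean value theorem on each leg; in the
    sup norm no leg leaves the ball of radius the norm of [h]. *)
Lemma increment_pderiv f x h :
  (forall y, `|y - x| <= `|h| -> forall a, derivable f y (delta_mx 0 a)) ->
  exists xi : 'I_n -> 'rV[R]_n, (forall a, `|xi a - x| <= `|h|) /\
    f (h + x) - f x = \sum_a h 0 a * pderiv a f (xi a).
Proof.
(* [tr k] keeps the first [k] entries of [h], so it runs from 0 to [h]. *)
move=> df; pose tr k : 'rV[R]_n := \row_j (if (j < k)%N then h 0 j else 0).
have trS (a : 'I_n) : tr a.+1 = h 0 a *: delta_mx 0 a + tr a.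
  apply/rowP => j; rewrite !mxE eqxx ltnS leq_eqVlt -val_eqE /=.
  case: eqP => [/val_inj ->|_] /=; first by rewrite ltnn mulr1 addr0.
  by rewrite mulr0 add0r.
have step (a : 'I_n) : exists y, `|y - x| <= `|h| /\
    f (tr a.+1 + x) - f (tr a + x) = h 0 a * pderiv a f y.
  have bnd (s : R) : `|s| <= `|h 0 a| ->
      `|s *: delta_mx 0 a + (tr a + x) - x| <= `|h|.
    move=> sh; rewrite addrA addrK; apply: row_norm_le => // j.
    rewrite !mxE eqxx /= -val_eqE; case: ltngtP => _ /=.
    - by rewrite mulr0 add0r row_entry_le_norm.
    - by rewrite mulr0 add0r normr0.
    - by rewrite mulr1 addr0 (le_trans sh) // row_entry_le_norm.
  have [s|s sh E] := @mvt_line f (delta_mx 0 a) (tr a + x) (h 0 a).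
    by move=> /bnd /df; exact.
  exists (s *: delta_mx 0 a + (tr a + x)); split; first exact: bnd.
  by rewrite trS -addrA E.
have [xi xiP] := choice step.
exists xi; split=> [a|]; first by have [] := xiP a.
have -> : f (h + x) - f x = f (tr n + x) - f (tr 0%N + x).
  congr (f (_ + _) - f _); first by apply/rowP => j; rewrite mxE ltn_ord.
  by rewrite -[LHS]add0r; congr (_ + _); apply/rowP => j; rewrite !mxE ltn0.
rewrite -(telescope_sumr (fun k => f (tr k + x))) // big_mkord.
by apply: eq_bigr => a _; have [_ ->] := xiP a.
Qed.

Lemma open_norm_ball U x : open U -> U x ->
  exists2 r : R, 0 < r & forall y, `|y - x| < r -> U y.
Proof.
move=> Uo Ux; have /nbhs_ballP[r r0 rU] : nbhs x U by exact: open_nbhs_nbhs.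
by exists r => // y yx; apply: rU; rewrite -ball_normE /ball_ /= distrC.
Qed.

(** Continuity of the partial derivatives compares their values at the intermediate points of
    [increment_pderiv] with those at [x]. *)
Lemma C1_differentiable U f x : open U -> Ck 1 U f -> U x -> differentiable f x.
Proof.
move=> Uo [_ fd] Ux.
pose df (h : 'rV[R]_n) : R := \sum_a h 0 a * pderiv a f x.
have df_lin : linear df.
  move=> c u w; rewrite /df scaler_sumr -big_split; apply: eq_bigr => a _ /=.
  by rewrite !mxE mulrDl scalerAl.
pose dfL := HB.pack_for {linear 'rV[R]_n -> R} df
  (GRing.isLinear.Build _ _ _ _ _ df_lin).
have dfc : continuous dfL.
  move=> y; rewrite /= /df.
  apply: (@cvg_big R _ +%R 0 _ _ _ (nbhs y)) => [|a _].
    exact: add_continuous.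
  by apply: cvgM; [exact: coord_continuous | exact: cvg_cst].
have main (e : R) : 0 < e ->
    \forall h \near (0 : 'rV[R]_n), `|f (h + x) - (f x + df h)| <= e * `|h|.
  move=> e0.
  (* The [n] error terms then sum to at most [e] times the norm of [h]; [n.+1] keeps the bound
     positive when [n] is 0. *)
  have e1 : 0 < e / n.+1%:R by rewrite divr_gt0.
  have near_d : nbhs x [set y | forall a,
      `|pderiv a f y - pderiv a f x| <= e / n.+1%:R].
    apply: (@filter_forall _ _ (fun a => [set y |
      `|pderiv a f y - pderiv a f x| <= e / n.+1%:R]) (nbhs x)) => a.
    have [/(_ x Ux) + _] := (fd a).2.
    by move=> /cvgrPdist_le /(_ _ e1); apply: filterS => y; rewrite distrC.
  have near_U : nbhs x U by exact: open_nbhs_nbhs.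
  have /nbhs_ballP[r r0 rP] : nbhs x ([set y | forall a,
      `|pderiv a f y - pderiv a f x| <= e / n.+1%:R] `&` U) by exact: filterI.
  have {}rP y : `|y - x| < r ->
      (forall a, `|pderiv a f y - pderiv a f x| <= e / n.+1%:R) /\ U y.
    by move=> yx; apply: rP; rewrite -ball_normE /ball_ /= distrC.
  apply/nbhs_ballP; exists r => // h.
  rewrite -ball_normE /ball_ /= sub0r normrN => hr.
  have [y yh a|xi [xih fE]] := @increment_pderiv f x h.
    by apply: (fd a).1; have [] := rP y (le_lt_trans yh hr).
  rewrite opprD addrA fE.
  rewrite -sumrB (le_trans (ler_norm_sum _ _ _)) //.
  apply: (@le_trans _ _ (\sum_(a < n) e / n.+1%:R * `|h|)).
    apply: ler_sum => a _; rewrite -mulrBr normrM mulrC.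
    rewrite ler_pM ?row_entry_le_norm //.
    by have [] := rP _ (le_lt_trans (xih a) hr).
  rewrite sumr_const card_ord -mulrnAl ler_wpM2r // -mulr_natr -mulrA.
  by rewrite ler_piMr ?(ltW e0) // ler_pdivrMl // mulr1 ler_nat.
have dE : 'd f x = dfL :> ('rV[R]_n -> R).
  by apply: diff_unique => //; apply/eqaddoP => e e0; exact: main.
apply/diff_locallyP; rewrite dE; split => //.
by apply/eqaddoP => e e0; exact: main.
Qed.

Lemma locally_constant U f x : open U -> U x ->
  (forall y, U y -> forall a, derivable f y (delta_mx 0 a) /\ pderiv a f y = 0) ->
  \forall y \near x, f y = f x.
Proof.
move=> Uo Ux fd; have [r r0 rU] := open_norm_ball Uo Ux.
apply/nbhs_ballP; exists r => // y; rewrite -ball_normE /ball_ /= distrC => yr.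
have [z zr a|xi [xir]] := @increment_pderiv f x (y - x).
  by apply: (fd z _ a).1; apply: rU; exact: le_lt_trans yr.
rewrite subrK => E; apply/eqP; rewrite -subr_eq0 E big1 // => a _.
by rewrite (fd _ _ a).2 ?mulr0 //; apply: rU; exact: le_lt_trans yr.
Qed.

End MeanValue.

Lemma dist_le_half (R : realFieldType) (p q c d e : R) :
  `|q - c| <= e / 2 -> `|p - d| <= e / 2 -> c = d -> `|p - q| <= e.
Proof.
move=> qc pd cd; rewrite -(subrKA d) (le_trans (ler_normD _ _)) //.
by rewrite [leRHS]splitr lerD // distrC -cd.
Qed.

(** * Symmetry of mixed partial derivatives *)

Section Schwarz.
Variables (R : realType) (n : nat).
Implicit Types (U : set 'rV[R]_n) (f g : 'rV[R]_n -> R) (v x y : 'rV[R]_n).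

Lemma derivable_shift f v w y : derivable f (w + y) v ->
  derivable (fun z => f (w + z)) y v /\
  'D_v (fun z => f (w + z)) y = 'D_v f (w + y).
Proof.
have E : (fun h =>
     h^-1 *: (((fun z => f (w + z)) \o shift y) (h *: v) - f (w + y)))
   = (fun h : R => h^-1 *: ((f \o shift (w + y)) (h *: v) - f (w + y))).
  by apply/funext => h /=; rewrite addrCA.
move=> df; split; first by rewrite /derivable E.
by rewrite /derive E.
Qed.

(* The second difference of [f], normalised by [t ^ 2], is a value of either
   mixed partial derivative. *)
Lemma second_difference U f x (t : R) a b : Ck 2 U f ->
  (forall y, `|y - x| <= `|t| + `|t| -> U y) ->
  exists2 y, `|y - x| <= `|t| + `|t| &
  f (t *: delta_mx 0 b + (t *: delta_mx 0 a + x)) - f (t *: delta_mx 0 a + x)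
    - (f (t *: delta_mx 0 b + x) - f x)
  = t * (t * pderiv b (pderiv a f) y).
Proof.
move=> [fc fd] tU.
pose ea : 'rV[R]_n := delta_mx 0 a; pose eb : 'rV[R]_n := delta_mx 0 b.
have near_x s r : `|s| <= `|t| -> `|r| <= `|t| ->
    `|r *: eb + (s *: ea + x) - x| <= `|t| + `|t|.
  move=> st rt; rewrite addrA addrK (le_trans (ler_normD _ _)) //.
  by rewrite lerD // (le_trans (norm_scale_delta _ _)).
have near_x0 s : `|s| <= `|t| -> `|s *: ea + x - x| <= `|t| + `|t|.
  move=> st; have := @near_x s 0 st; rewrite scale0r add0r; apply.
  by rewrite normr0.
pose g y := f (t *: eb + y) - f y.
have dg s : `|s| <= `|t| -> derivable g (s *: ea + x) ea /\
    'D_ea g (s *: ea + x) =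
      pderiv a f (t *: eb + (s *: ea + x)) - pderiv a f (s *: ea + x).
  move=> st; have [|d1 E1] := @derivable_shift f ea (t *: eb) (s *: ea + x).
    by apply: (fd a).1; apply: tU; exact: near_x.
  have d0 : derivable f (s *: ea + x) ea.
    by apply: (fd a).1; apply: tU; exact: near_x0.
  have -> : g = (fun z => f (t *: eb + z)) - f by [].
  by split; [exact: derivableB d1 d0 | rewrite (deriveB d1 d0) E1].
have [s /dg[]//|s st E] := @mvt_line _ _ g ea x t.
have [r rt|r rt E2] := @mvt_line _ _ (pderiv a f) eb (s *: ea + x) t.
  by apply: ((fd a).2.2 b).1; apply: tU; exact: near_x.
exists (r *: eb + (s *: ea + x)); first exact: near_x.
by rewrite -[LHS]/(g (t *: ea + x) - g x) E (dg _ st).2 E2.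
Qed.

(** The second difference is symmetric in the two directions, so the two mixed derivatives agree at
    two points near [x]; continuity carries this to [x]. *)
Lemma pderivC U f x a b : open U -> Ck 2 U f -> U x ->
  pderiv a (pderiv b f) x = pderiv b (pderiv a f) x.
Proof.
move=> Uo fC Ux; apply/eqP; rewrite -subr_eq0 -normr_le0.
apply/ler_addgt0Pr => e e0.
rewrite add0r.
have near_d c d : nbhs x [set y |
    `|pderiv c (pderiv d f) x - pderiv c (pderiv d f) y| <= e / 2].
  have := ((fC.2 d).2.2 c).2.1 x Ux.
  by move=> /cvgrPdist_le; apply; rewrite divr_gt0.
have near_U : nbhs x U by exact: open_nbhs_nbhs.
pose W := U `&`
    ([set y | `|pderiv a (pderiv b f) x - pderiv a (pderiv b f) y| <= e / 2] `&`
     [set y | `|pderiv b (pderiv a f) x - pderiv b (pderiv a f) y| <= e / 2]).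
have /nbhs_ballP[r r0 rP] : nbhs x W.
  by apply: filterI near_U _; exact: filterI (near_d a b) (near_d b a).
have {}r0 : 0 < r by [].
have {}rP y : `|y - x| < r -> W y.
  by move=> yx; apply: rP; rewrite -ball_normE /ball_ /= distrC.
(* The intermediate points lie within [2 * t] of [x], hence inside the ball of radius [r]. *)
pose t := r / 3.
have t0 : 0 < t by rewrite divr_gt0.
have tr : `|t| + `|t| < r by rewrite gtr0_norm // /t; lra.
have tU y : `|y - x| <= `|t| + `|t| -> U y.
  by move=> yx; have [] := rP y (le_lt_trans yx tr).
have [y yx Ey] := second_difference a b fC tU.
have [z zx Ez] := second_difference b a fC tU.
have yz : pderiv b (pderiv a f) y = pderiv a (pderiv b f) z.
  have : t * (t * pderiv b (pderiv a f) y) = t * (t * pderiv a (pderiv b f) z).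
    have swap (p q u w : R) : p - q - (u - w) = p - u - (q - w) by ring.
    have cross : t *: delta_mx 0 b + (t *: delta_mx 0 a + x)
        = t *: delta_mx 0 a + (t *: delta_mx 0 b + x) by exact: addrCA.
    by apply: etrans (esym Ey) (etrans _ Ez); rewrite cross swap.
  by move=> /(mulfI (lt0r_neq0 t0)) /(mulfI (lt0r_neq0 t0)).
have [_ [_ Hy]] := rP y (le_lt_trans yx tr).
have [_ [Hz _]] := rP z (le_lt_trans zx tr).
exact: dist_le_half Hy Hz yz.
Qed.

End Schwarz.

Lemma derive_line (R : realType) (V W : normedModType R) (F : V -> W) v x :
  'D_1 (fun s : R => F (s *: v + x)) 0 = 'D_v F x.
Proof.
have E : (fun s : R => s^-1 *: (F ((s%:A + 0) *: v + x) - F (0 *: v + x)))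
    = (fun s => s^-1 *: (F (s *: v + x) - F x)).
  by apply/funext => s; rewrite addr0 scale0r add0r [_%:A]mulr1.
by rewrite /derive /= E.
Qed.

(** * Chain rule, and stability of regularity under composition and inversion *)

Section ChainRule.
Variables (R : realType) (n m : nat).
Implicit Types (U : set 'rV[R]_n) (V : set 'rV[R]_m).

Lemma row_continuous (t : 'rV[R]_n -> 'rV[R]_m) x :
  (forall b, {for x, continuous (fun y => t y 0 b)}) -> {for x, continuous t}.
Proof.
move=> tc W [P nP PW].
have /filter_forall nb : forall b, nbhs x [set y | P 0 b (t y 0 b)].
  by move=> b; exact: tc b _ (nP 0 b).
apply: filterS nb => y yP; apply: PW => i j; rewrite ord1; exact: yP.
Qed.

(** Restricting [t] to the line through [x] along axis [a] gives a differentiable curve, to which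
    the differential of [h] is applied. *)
Lemma pderiv_comp (V : set 'rV[R]_m) (h : 'rV[R]_m -> R)
    (t : 'rV[R]_n -> 'rV[R]_m) x a :
  open V -> Ck 1 V h -> V (t x) ->
  (forall b, derivable (fun y => t y 0 b) x (delta_mx 0 a)) ->
  derivable (h \o t) x (delta_mx 0 a) /\
  pderiv a (h \o t) x = \sum_b pderiv a (fun y => t y 0 b) x * pderiv b h (t x).
Proof.
move=> Vo hC Vt dt.
have dh : differentiable h (t x) := C1_differentiable Vo hC Vt.
have dtx : derivable t x (delta_mx 0 a).
  by apply/derivable_mxP => i b; rewrite ord1; exact: dt.
pose ga (s : R) := t (s *: delta_mx 0 a + x).
have ga0 : ga 0 = t x by rewrite /ga scale0r add0r.
have dga : differentiable ga 0.
  exact: (proj1 (derivable1_diffP ga 0) (proj1 (derivable1P t x _) dtx)).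
have dhga : differentiable h (ga 0) by rewrite ga0.
have gaE : 'D_1 ga 0 = \row_b pderiv a (fun y => t y 0 b) x.
  by rewrite derive_line derive_mx //; apply/rowP => b; rewrite !mxE.
split.
  apply: (proj2 (derivable1P (h \o t) x _)).
  apply: (proj2 (derivable1_diffP (h \o ga) 0)).
  exact: (differentiable_comp dga dhga).
rewrite /pderiv -(derive_line (h \o t)) -[fun s : R => _]/(h \o ga).
rewrite deriveE; last exact: differentiable_comp.
rewrite diff_comp //= -(deriveE (1 : R) dga) gaE ga0.
rewrite [X in 'd h _ X]row_sum_delta linear_sum.
by apply: eq_bigr => b _; rewrite linearZ /= -(deriveE _ dh) mxE.
Qed.

Lemma Ck_sum k U I (r : seq I) (P : pred I) (F : I -> 'rV[R]_n -> R) : open U ->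
  (forall i, P i -> Ck k U (F i)) -> Ck k U (fun x => \sum_(i <- r | P i) F i x).
Proof.
move=> Uo FC; elim: r => [|i r IH].
  under eq_fun do rewrite big_nil.
  exact: (@smooth_cst R n U 0 k).
under eq_fun do rewrite big_cons.
case: (boolP (P i)) => // Pi; apply: Ck_add => //; exact: FC.
Qed.

Lemma CkW1 p k (U : set 'rV[R]_p) f : Ck k.+1 U f -> Ck 1 U f.
Proof. by elim: k => // k IH /CkW. Qed.

Lemma Ck_comp k U V (h : 'rV[R]_m -> R) (t : 'rV[R]_n -> 'rV[R]_m) :
  open U -> open V -> (forall x, U x -> V (t x)) ->
  Ck k V h -> (forall b, Ck k U (fun x => t x 0 b)) -> Ck k U (h \o t).
Proof.
move=> Uo Vo UV; elim: k h => [|k IH] h hC tC.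
  split=> // x Ux; apply: continuous_comp; last exact: hC.1 (UV _ Ux).
  by apply: row_continuous => b; exact: (tC b).1.
have C1 x a : U x -> _ := fun Ux => pderiv_comp Vo (CkW1 hC) (UV _ Ux)
  (fun b => ((tC b).2 a).1 x Ux).
split=> [x Ux|a].
  apply: continuous_comp; last exact: hC.1 (UV _ Ux).
  by apply: row_continuous => b; exact: (tC b).1.
split=> [x Ux|]; first exact: (C1 x a Ux).1.
apply: (@Ck_eq _ _ k U (fun x =>
  \sum_b pderiv a (fun y => t y 0 b) x * (pderiv b h \o t) x)) => //.
  by move=> x Ux; rewrite (C1 x a Ux).2.
apply: Ck_sum => // b _; apply: Ck_mul => //; first exact: ((tC b).2 a).2.
apply: IH; first exact: (hC.2 b).2.
by move=> c; exact: CkW.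
Qed.

Lemma Ck_inv k U (f : 'rV[R]_n -> R) : open U ->
  (forall x, U x -> f x != 0) -> Ck k U f -> Ck k U (fun x => (f x)^-1).
Proof.
move=> Uo f0; elim: k => [|k IH] fC.
  by split=> // x Ux; exact: cvgV (f0 x Ux) (fC.1 x Ux).
split=> [x Ux|a]; first exact: cvgV (f0 x Ux) (fC.1 x Ux).
have fdx x : U x -> derivable f x (delta_mx 0 a) by exact: (fC.2 a).1.
split=> [x Ux|]; first by apply: derivableV; [exact: f0 | exact: fdx].
apply: (@Ck_eq _ _ k U
  (fun x => -1 * (((f x)^-1 * (f x)^-1) * pderiv a f x))) => //.
  move=> x Ux; rewrite /pderiv deriveV ?f0 //; last exact: fdx.
  by rewrite mulN1r [in RHS]/GRing.scale /= expr2 invfM mulNr.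
have fVC := IH (CkW fC).
apply: Ck_mul => //; first exact: smooth_cst.
by apply: Ck_mul; [|exact: Ck_mul|exact: (fC.2 a).2].
Qed.

End ChainRule.

(** * The ring of smooth functions on an open set *)

Section SmoothRing.
Variables (R : realType) (n : nat).

(** Openness is bundled so that a single object can index the ring of smooth functions. *)
Record open_set := OpenSet { oset : set 'rV[R]_n; oset_open : open oset }.

Arguments oset_open : clear implicits.
Implicit Types (U : open_set).

(** [pderiv] needs a function on the whole space. As [oset U] is open, the default 0 outside never
    affects a derivative inside. *)
Definition extend U (f : oset U -> R) (x : 'rV[R]_n) : R :=
  if pselect (oset U x) is left Ux then f (SigSub (mem_set Ux)) else 0.

Lemma extendE U (f : oset U -> R) (x : oset U) : extend f (val x) = f x.
Proof.
rewrite /extend; case: pselect => [Ux|]; last by have := set_valP x.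
by congr f; exact: val_inj.
Qed.

Lemma extendK U (f : 'rV[R]_n -> R) x : oset U x ->
  extend (fun y : oset U => f (val y)) x = f x.
Proof. by move=> Ux; rewrite /extend; case: pselect. Qed.

Lemma smooth_eq U (f g : 'rV[R]_n -> R) : (forall x, oset U x -> f x = g x) ->
  smooth_on (oset U) f -> smooth_on (oset U) g.
Proof. by move=> fg fs k; exact: (Ck_eq (oset_open U) fg (fs k)). Qed.

Lemma extend_val U (f : oset U -> R) x (Ux : oset U x) :
  extend f x = f (SigSub (mem_set Ux)).
Proof. by rewrite -extendE. Qed.

Definition smooth_pred U : {pred oset U -> R} :=
  [pred f | `[< smooth_on (oset U) (extend f) >]].

Lemma smooth_subring U : subring_closed (@smooth_pred U).
Proof.
have oU := oset_open U.
have sub (f g : oset U -> R) x : oset U x ->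
    extend f x + -1 * extend g x = extend (f - g) x.
  by move=> Ux; rewrite !(extend_val _ Ux) mulN1r.
split=> [|f g /asboolP fs /asboolP gs|f g /asboolP fs /asboolP gs]; apply/asboolP.
- apply: smooth_eq (@smooth_cst R n (oset U) 1) => x Ux.
  by rewrite (extend_val _ Ux).
- apply: smooth_eq (sub f g) _ => k; apply: Ck_add => //.
  by apply: Ck_mul => //; exact: smooth_cst.
- apply: (@smooth_eq U (fun x => extend f x * extend g x)) => [x Ux|k].
    by rewrite !(extend_val _ Ux).
  exact: Ck_mul.
Qed.

HB.instance Definition _ U :=
  GRing.isSubringClosed.Build (oset U -> R) (@smooth_pred U) (@smooth_subring U).

(** Functions on the subtype, not on the whole space: equality then means equality on [oset U], and
    [smooth_ringP] proves it pointwise. *)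
Record smooth_ring U := SmoothRing {
  sring_fun : oset U -> R;
  sring_smooth : sring_fun \in @smooth_pred U
}.

HB.instance Definition _ U := [isSub for @sring_fun U].
HB.instance Definition _ U := [Choice of smooth_ring U by <:].
HB.instance Definition _ U := GRing.SubChoice_isSubComPzRing.Build
  (oset U -> R) (@smooth_pred U) (smooth_ring U) (@smooth_subring U).

(** Evaluation at a point; as a ring morphism it sends identities over the smooth ring to identities
    of real matrices. *)
Definition sval_at U (x : oset U) (k : smooth_ring U) : R := sring_fun k x.

Arguments sval_at : simpl never.

Lemma sval_at_zmod U (x : oset U) : zmod_morphism (sval_at x).
Proof. by []. Qed.

Lemma sval_at_monoid U (x : oset U) : monoid_morphism (sval_at x).
Proof. by []. Qed.

HB.instance Definition _ U x :=
  GRing.isZmodMorphism.Build (smooth_ring U) R (@sval_at U x) (@sval_at_zmod U x).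
HB.instance Definition _ U x :=
  GRing.isMonoidMorphism.Build (smooth_ring U) R (@sval_at U x) (@sval_at_monoid U x).

Lemma sval_atD U (x : oset U) k l : sval_at x (k + l) = sval_at x k + sval_at x l.
Proof. by []. Qed.

Lemma sval_atB U (x : oset U) k l : sval_at x (k - l) = sval_at x k - sval_at x l.
Proof. by []. Qed.

Lemma sval_atM U (x : oset U) k l : sval_at x (k * l) = sval_at x k * sval_at x l.
Proof. by []. Qed.

Lemma sval_at_sum U (x : oset U) I (r : seq I) (P : pred I) F :
  sval_at x (\sum_(i <- r | P i) F i) = \sum_(i <- r | P i) sval_at x (F i).
Proof. exact: (rmorph_sum (sval_at x)). Qed.

Lemma smooth_ringP U (k l : smooth_ring U) :
  (forall x, sval_at x k = sval_at x l) -> k = l.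
Proof. by move=> kl; apply: val_inj; apply/funext => x; exact: kl. Qed.

Definition sext U (k : smooth_ring U) : 'rV[R]_n -> R := extend (sring_fun k).

Lemma sext_smooth U (k : smooth_ring U) : smooth_on (oset U) (sext k).
Proof. by apply/asboolP; exact: sring_smooth. Qed.

Lemma sextE U (k : smooth_ring U) (x : oset U) : sext k (val x) = sval_at x k.
Proof. exact: extendE. Qed.

Lemma restrict_smooth U (f : 'rV[R]_n -> R) : smooth_on (oset U) f ->
  (fun x : oset U => f (val x)) \in @smooth_pred U.
Proof.
move=> fs; apply/asboolP; apply: smooth_eq fs => x Ux.
by rewrite extendK.
Qed.

Definition srestr U f (fs : smooth_on (oset U) f) : smooth_ring U :=
  SmoothRing (restrict_smooth fs).

Lemma srestrE U f (fs : smooth_on (oset U) f) (x : oset U) :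
  sval_at x (srestr fs) = f (val x).
Proof. by []. Qed.

Lemma sext_srestr U f (fs : smooth_on (oset U) f) x : oset U x ->
  sext (srestr fs) x = f x.
Proof. by move=> Ux; exact: extendK. Qed.

Lemma smooth_pderiv U a f : smooth_on (oset U) f -> smooth_on (oset U) (pderiv a f).
Proof. by move=> fs k; exact: ((fs k.+1).2 a).2. Qed.

Definition sderiv U (a : 'I_n) (k : smooth_ring U) : smooth_ring U :=
  srestr (smooth_pderiv a (sext_smooth k)).

Lemma sderivE U a k (x : oset U) :
  sval_at x (sderiv a k) = pderiv a (sext k) (val x).
Proof. by []. Qed.

Lemma sval_at_sderiv U a k f (x : oset U) : (forall y, oset U y -> sext k y = f y) ->
  sval_at x (sderiv a k) = pderiv a f (val x).
Proof.
move=> kf; rewrite sderivE; apply: near_eq_derive.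
exact: near_eqU (oset_open U) kf (set_valP x).
Qed.

Lemma sext_derivable U a (k : smooth_ring U) (x : oset U) :
  derivable (sext k) (val x) (delta_mx 0 a).
Proof. exact: ((sext_smooth k 1).2 a).1 (set_valP x). Qed.

Lemma sextD U (k l : smooth_ring U) x : oset U x ->
  sext (k + l) x = sext k x + sext l x.
Proof. by move=> Ux; rewrite /sext !(extend_val _ Ux). Qed.

Lemma sextM U (k l : smooth_ring U) x : oset U x ->
  sext (k * l) x = sext k x * sext l x.
Proof. by move=> Ux; rewrite /sext !(extend_val _ Ux). Qed.

Lemma sderivD U a (k l : smooth_ring U) :
  sderiv a (k + l) = sderiv a k + sderiv a l.
Proof.
apply: smooth_ringP => x; rewrite (sval_at_sderiv a x (sextD k l)).
by rewrite sval_atD !sderivE /pderiv deriveD //; exact: sext_derivable.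
Qed.

Lemma sderivM U a (k l : smooth_ring U) :
  sderiv a (k * l) = sderiv a k * l + k * sderiv a l.
Proof.
apply: smooth_ringP => x; rewrite (sval_at_sderiv a x (sextM k l)).
rewrite sval_atD !sval_atM !sderivE -!sextE.
rewrite /pderiv deriveM; [|exact: sext_derivable..].
by rewrite addrC [X in X + _]mulrC.
Qed.

Lemma sderivC U a b (k : smooth_ring U) :
  sderiv a (sderiv b k) = sderiv b (sderiv a k).
Proof.
have E c d (x : oset U) : sval_at x (sderiv c (sderiv d k)) =
    pderiv c (pderiv d (sext k)) (val x).
  by apply: sval_at_sderiv => y Uy; rewrite sext_srestr.
apply: smooth_ringP => x; rewrite !E.
exact: pderivC (oset_open U) (sext_smooth k 2) (set_valP x).
Qed.

Definition smooth_frame U : frame (smooth_ring U) n :=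
  Frame (@sderivD U) (@sderivM U) (@sderivC U).

End SmoothRing.

Arguments oset_open {R n} _.

(** * Pullback of smooth functions along a smooth map *)

Section Pullback.
Variables (R : realType) (n m : nat) (U : open_set R n) (V : open_set R m).
Variable t : 'rV[R]_n -> 'rV[R]_m.
Hypothesis tUV : forall x, oset U x -> oset V (t x).
Hypothesis ts : forall b, smooth_on (oset U) (fun x => t x 0 b).

Lemma smooth_comp h : smooth_on (oset V) h -> smooth_on (oset U) (h \o t).
Proof.
move=> hs k.
exact: (Ck_comp (oset_open U) (oset_open V) tUV (hs k) (fun b => ts b k)).
Qed.

Definition pullback (k : smooth_ring V) : smooth_ring U :=
  srestr (smooth_comp (sext_smooth k)).

Definition map_pt (x : oset U) : oset V := SigSub (mem_set (tUV (set_valP x))).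

Lemma sval_at_pullback x k : sval_at x (pullback k) = sval_at (map_pt x) k.
Proof. by rewrite srestrE /= -sextE. Qed.

Lemma pullback_zmod : zmod_morphism pullback.
Proof.
move=> k l; apply: smooth_ringP => x.
by rewrite sval_atB !sval_at_pullback sval_atB.
Qed.

Lemma pullback_monoid : monoid_morphism pullback.
Proof.
split=> [|k l]; apply: smooth_ringP => x.
  by rewrite sval_at_pullback.
by rewrite sval_atM !sval_at_pullback sval_atM.
Qed.

HB.instance Definition _ :=
  GRing.isZmodMorphism.Build (smooth_ring V) (smooth_ring U) pullback pullback_zmod.
HB.instance Definition _ :=
  GRing.isMonoidMorphism.Build (smooth_ring V) (smooth_ring U) pullback pullback_monoid.

Lemma pullback_chain a k : sderiv a (pullback k)
  = \sum_b sderiv a (srestr (ts b)) * pullback (sderiv b k).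
Proof.
apply: smooth_ringP => x; rewrite sval_at_sum.
have Ux := set_valP x.
have [_ E] := @pderiv_comp R n m (oset V) (sext k) t (val x) a
  (oset_open V) (sext_smooth k 1) (tUV Ux) (fun b => ((ts b 1).2 a).1 _ Ux).
rewrite (sval_at_sderiv a x (f := sext k \o t)); last first.
  by move=> y Uy; rewrite sext_srestr.
rewrite E; apply: eq_bigr => b _; rewrite sval_atM; congr (_ * _).
  rewrite (sval_at_sderiv a x (f := fun y => t y 0 b)) // => y Uy.
  by rewrite sext_srestr.
by rewrite srestrE /= sext_srestr //; exact: tUV.
Qed.

End Pullback.

(** * Curvature in charts *)

Lemma sval_at_curv (R : realType) (n : nat) (U : open_set R n)
    (A : 'I_n -> 'M[smooth_ring U]_n)
    (Ga : 'I_n -> 'I_n -> 'I_n -> 'rV[R]_n -> R)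
    d c a b (x : oset U) :
  (forall e a b (y : oset U), sval_at y (A a e b) = Ga e a b (val y)) ->
  sval_at x (curv (smooth_frame U) A a b d c) =
  pderiv a (Ga d b c) (val x) - pderiv b (Ga d a c) (val x)
  + \sum_e (Ga d a e (val x) * Ga e b c (val x)
            - Ga d b e (val x) * Ga e a c (val x)).
Proof.
move=> AGa.
have dE e f f' h : sval_at x (smooth_frame U e (A f f' h)) =
    pderiv e (Ga f' f h) (val x).
  apply: sval_at_sderiv => y Uy.
  by rewrite -[y]/(val (SigSub (mem_set Uy) : oset U)) sextE AGa.
rewrite curv_entry sval_atD sval_atB !dE sval_at_sum; congr (_ + _).
by apply: eq_bigr => e _; rewrite sval_atB !sval_atM !AGa.
Qed.

Section ChartMetric.
Variables (R : realType) (n : nat) (M : manifold R n) (g : pseudo_metric M).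
Variables (i : Defs.index M) (U : open_set R n).
Hypothesis Ui : oset U `<=` cimg i.

Lemma chart_metric_smooth a b : smooth_on (oset U) (fun x => g i x a b).
Proof. by move=> k; exact: CkS Ui (mcomp_smooth g i a b k). Qed.

(** [U] is any open subset of the chart image: the whole image serves Schur's lemma, an overlap
    serves the change of charts. *)
Definition chart_metric : 'M[smooth_ring U]_n :=
  \matrix_(a, b) srestr (chart_metric_smooth a b).

Lemma chart_metricE (x : oset U) : map_mx (sval_at x) chart_metric = g i (val x).
Proof. by apply/matrixP => a b; rewrite !mxE. Qed.

Lemma sext_mx (A : 'M[smooth_ring U]_n) (x : oset U) a b :
  sext (A a b) (val x) = map_mx (sval_at x) A a b.
Proof. by rewrite sextE mxE. Qed.

(** Cramer's rule: the inverse is the adjugate divided by the determinant, which nondegeneracy keeps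
    away from 0. *)
Lemma chart_inv_smooth a b : smooth_on (oset U) (fun x => invmx (g i x) a b).
Proof.
pose d := sext (\det chart_metric).
have dE (x : oset U) : d (val x) = \det (g i (val x)).
  by rewrite /d sextE -chart_metricE det_map_mx.
have dU x : oset U x -> d x = \det (g i x).
  by move=> Ux; exact: dE (SigSub (mem_set Ux)).
apply: (@smooth_eq R n U (fun x => (d x)^-1 * sext (\adj chart_metric a b) x)).
  move=> x Ux; have gu := mcomp_nondeg g (Ui Ux); rewrite dU // /invmx gu [RHS]mxE.
  congr (_ * _); rewrite -[x in LHS]/(val (SigSub (mem_set Ux) : oset U)) sext_mx.
  by rewrite map_mx_adj chart_metricE.
move=> k; apply: Ck_mul (sext_smooth _ k); first exact: oset_open.
apply: Ck_inv (sext_smooth _ k); first exact: oset_open.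
move=> x Ux; have := mcomp_nondeg g (Ui Ux).
by rewrite unitmxE unitfE -dU.
Qed.

Definition chart_inv : 'M[smooth_ring U]_n :=
  \matrix_(a, b) srestr (chart_inv_smooth a b).

Definition half : smooth_ring U := srestr (@smooth_cst R n (oset U) 2^-1).

Lemma half2 : half + half = 1.
Proof.
apply: smooth_ringP => x; rewrite sval_atD srestrE.
by rewrite -[RHS]/(1 : R) [RHS]splitr mul1r.
Qed.

Lemma chart_metricV : chart_metric *m chart_inv = 1%:M.
Proof.
apply/matrixP => a b; apply: smooth_ringP => x.
have gu := mcomp_nondeg g (Ui (set_valP x)).
have /matrixP/(_ a b) := mulmxV gu; rewrite !mxE => E.
transitivity ((a == b)%:R : R); last by rewrite /sval_at; case: (a == b).
rewrite -E sval_at_sum; apply: eq_bigr => c _.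
by rewrite sval_atM !mxE !srestrE.
Qed.

Lemma chart_metricT : chart_metric^T = chart_metric.
Proof.
apply/matrixP => a b; apply: smooth_ringP => x.
have /matrixP/(_ a b) := mcomp_sym g (Ui (set_valP x)).
by rewrite !mxE !srestrE.
Qed.

Definition chart_conn := levi_civita (smooth_frame U) chart_metric chart_inv half.

Lemma chart_connE e a b (x : oset U) :
  sval_at x (chart_conn a e b) = christoffel g i e a b (val x).
Proof.
have dE c d d' : sval_at x (sderiv c (chart_metric d d')) =
    pderiv c (fun y => g i y d d') (val x).
  by apply: sval_at_sderiv => y Uy; rewrite mxE sext_srestr.
rewrite mxE sval_atM srestrE sval_at_sum; congr (_ * _); apply: eq_bigr => d _.
by rewrite sval_atM sval_atB sval_atD mxE srestrE !dE.
Qed.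

Lemma chart_curvE d c a b (x : oset U) :
  sval_at x (curv (smooth_frame U) chart_conn a b d c) = riemann g i d c a b (val x).
Proof.
exact: (sval_at_curv d c a b x chart_connE).
Qed.

(** The bridge from the algebraic Ricci matrix to the coordinate Ricci tensor. *)
Lemma chart_ricE (x : oset U) :
  map_mx (sval_at x) (ric (smooth_frame U) chart_conn) = ricci g i (val x).
Proof.
apply/matrixP => b c; rewrite !mxE sval_at_sum.
by apply: eq_bigr => a _; exact: chart_curvE.
Qed.

End ChartMetric.

(** * The Ricci tensor under transition maps *)

Section RicciInvariance.
Variables (R : realType) (n : nat) (M : manifold R n) (g : pseudo_metric M).

Lemma overlap_open (i j : Defs.index M) : open (overlap i j).
Proof.
rewrite openE => x [ix jx].
apply: (@filterI _ (nbhs x) _ (cimg i)).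
  by apply: open_nbhs_nbhs; split => //; exact: cimg_open.
apply: (param_continuous ix); apply: open_nbhs_nbhs; split => //.
exact: cdom_open.
Qed.

Definition overlap_set (i j : Defs.index M) := OpenSet (@overlap_open i j).

Lemma overlap_sub (i j : Defs.index M) : overlap i j `<=` cimg i.
Proof. by move=> x []. Qed.

Lemma transition_overlap (i j : Defs.index M) x :
  overlap i j x -> overlap j i (transition i j x).
Proof.
move=> [ix jx]; split; first exact: chart_img.
by rewrite /transition chartK //; exact: param_dom.
Qed.

(** Instance of [ric_transform] over the rings of the two overlaps, with the pullback along the
    transition map as [phi], evaluated at [x]. *)
Lemma ricci_transform (i j : Defs.index M) x : overlap i j x ->
  ricci g i x = jac (transition i j) x *m ricci g j (transition i j x)
    *m (jac (transition i j) x)^T.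
Proof.
move=> ov.
pose U := overlap_set i j; pose V := overlap_set j i.
have Ui : oset U `<=` cimg i by exact: overlap_sub.
have Vj : oset V `<=` cimg j by exact: overlap_sub.
have tUV y : oset U y -> oset V (transition i j y) by exact: transition_overlap.
have ts b : smooth_on (oset U) (fun y => transition i j y 0 b).
  exact: transition_smooth.
pose J : 'M[smooth_ring U]_n := \matrix_(a, b) sderiv a (srestr (ts b)).
have JE (y : oset U) : map_mx (sval_at y) J = jac (transition i j) (val y).
  apply/matrixP => a b; rewrite !mxE; apply: sval_at_sderiv => z Uz.
  by rewrite sext_srestr.
have phiE (y : oset U) (A : 'M[smooth_ring V]_n) :
    map_mx (sval_at y) (map_mx (pullback tUV ts) A) =
    map_mx (sval_at (map_pt tUV y)) A.
  by apply/matrixP => a b; rewrite !mxE sval_at_pullback.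
have matP (A B : 'M[smooth_ring U]_n) :
    (forall y, map_mx (sval_at y) A = map_mx (sval_at y) B) -> A = B.
  move=> AB; apply/matrixP => a b; apply: smooth_ringP => y.
  by have /matrixP/(_ a b) := AB y; rewrite !mxE.
have chain a k : smooth_frame U a (pullback tUV ts k)
    = \sum_b J a b * pullback tUV ts (smooth_frame V b k).
  by rewrite [LHS]pullback_chain; apply: eq_bigr => b _; rewrite mxE.
have J_sym a b c : smooth_frame U a (J b c) = smooth_frame U b (J a c).
  by rewrite !mxE; exact: fderC.
have gE : chart_metric g Ui =
    J *m map_mx (pullback tUV ts) (chart_metric g Vj) *m J^T.
  apply: matP => y; rewrite !map_mxM -map_trmx JE phiE !chart_metricE.
  exact: mcomp_transform (set_valP y).
have := ric_transform (half2 U) chain J_sym gE (chart_metricT g Ui)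
  (chart_metricV g Ui)
  (levi_civita_torsion_free _ _ _ (chart_metricT g Ui))
  (levi_civita_metric _ (chart_metricT g Ui) (chart_metricV g Ui) (half2 U))
  (levi_civita_torsion_free _ _ _ (chart_metricT g Vj))
  (levi_civita_metric _ (chart_metricT g Vj) (chart_metricV g Vj) (half2 V)).
move/(congr1 (map_mx (sval_at (SigSub (mem_set ov) : oset U)))).
by rewrite chart_ricE !map_mxM -map_trmx JE phiE chart_ricE.
Qed.

End RicciInvariance.

(** * Schur's lemma and solitons *)

Lemma scale_unitmx_inj (F : fieldType) n (A : 'M[F]_n) (c d : F) :
  (0 < n)%N -> A \in unitmx -> c *: A = d *: A -> c = d.
Proof.
move=> n0 Au /(congr1 (fun X => X *m invmx A)).
rewrite -!scalemxAl mulmxV // => /matrixP/(_ (Ordinal n0) (Ordinal n0)).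
by rewrite !mxE eqxx !mulr1.
Qed.

(** Any condition on the value of [S] defines an open set, so a level set is both open and
    closed. *)
Lemma locally_constant_connected (T : topologicalType) (X : Type) (S : T -> X) :
  connected [set: T] -> (forall p, \forall q \near p, S q = S p) ->
  forall p q, S p = S q.
Proof.
move=> cT Sloc p q; pose B := [set z | S z = S q].
have openS (P : set X) : open [set z | P (S z)].
  rewrite openE => z Pz; apply: filterS (Sloc z) => w wz.
  by rewrite /= wz.
have : B = setT.
  apply: cT; first by exists q.
  - by exists B; [exact: (openS (fun c => c = S q)) | rewrite setTI].
  - exists B; last by rewrite setTI.
    rewrite -openC; exact: (openS (fun c => c <> S q)).
by move=> /seteqP[_ /(_ p I)].
Qed.

Section Schur.
Variables (R : realType) (n : nat) (M : manifold R n) (g : pseudo_metric M).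

Lemma scalar_curvature_proportional (i : Defs.index M) x c :
  cimg i x -> ricci g i x = c *: g i x ->
  scalar_curvature g i x = n%:R * c.
Proof.
move=> ix Ec; rewrite /scalar_curvature Ec.
transitivity (\sum_(b < n) c); last by rewrite sumr_const card_ord mulr_natl.
apply: eq_bigr => b _.
transitivity (c * (invmx (g i x) *m (g i x)^T) b b).
  by rewrite mxE mulr_sumr; apply: eq_bigr => a _; rewrite !mxE mulrCA.
by rewrite mcomp_sym // mulVmx ?mcomp_nondeg // mxE eqxx mulr1.
Qed.

Hypothesis n3 : (3 <= n)%N.
Variable s : Defs.index M -> 'rV[R]_n -> R.
Hypothesis ric_s : forall i x, cimg i x -> ricci g i x = s i x *: g i x.

(** [s] is not assumed smooth, but it is the scalar curvature divided by [n]: this is [sK], whose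
    derivatives [schur_identity] kills. *)
Lemma schur_chart (i : Defs.index M) x :
  cimg i x -> \forall y \near x, s i y = s i x.
Proof.
move=> ix; pose U := OpenSet (@cimg_open _ _ M i).
have Ui : oset U `<=` cimg i by [].
pose sK : smooth_ring U := srestr (@smooth_cst R n (oset U) n%:R^-1) *
  \sum_b \sum_c chart_inv g Ui b c * ric (smooth_frame U) (chart_conn g Ui) b c.
have n0 : n%:R != 0 :> R by rewrite pnatr_eq0 -lt0n (leq_trans _ n3).
have ricE (y : oset U) b c : sval_at y (ric (smooth_frame U) (chart_conn g Ui) b c)
    = ricci g i (val y) b c.
  by rewrite -chart_ricE [RHS]mxE.
have sKE (y : oset U) : sval_at y sK = s i (val y).
  rewrite sval_atM srestrE -[RHS](mulKf n0); congr (_ * _).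
  rewrite -(scalar_curvature_proportional (set_valP y) (ric_s (set_valP y))).
  rewrite sval_at_sum; apply: eq_bigr => b _; rewrite sval_at_sum.
  by apply: eq_bigr => c _; rewrite sval_atM ricE mxE srestrE.
have ricK : ric (smooth_frame U) (chart_conn g Ui) = sK *: chart_metric g Ui.
  apply/matrixP => b c; apply: smooth_ringP => y.
  rewrite ricE (ric_s (set_valP y)) [in RHS]mxE sval_atM sKE mxE; congr (_ * _).
  by rewrite mxE.
have dsK (y : oset U) a : pderiv a (sext sK) (val y) = 0.
  have := schur_identity (chart_metricT g Ui) (chart_metricV g Ui)
    (levi_civita_torsion_free _ _ _ (chart_metricT g Ui))
    (levi_civita_metric _ (chart_metricT g Ui) (chart_metricV g Ui) (half2 U))
    ricK a.
  move/(congr1 (sval_at y)); rewrite !(raddfMn (sval_at y)) /= => /eqP.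
  (* The identity now reads [n - 2] times the derivative equals 0, and [n - 2] is nonzero. *)
  rewrite -subr_eq0 -mulrnBr ?(leq_trans _ n3) // mulrn_eq0 subn_eq0 leqNgt n3 /=.
  by move/eqP.
have sE y : oset U y -> sext sK y = s i y.
  by move=> Uy; rewrite -[y]/(val (SigSub (mem_set Uy) : oset U)) sextE sKE.
have near_x : \forall y \near x, sext sK y = sext sK x.
  apply: (@locally_constant R n (oset U) (sext sK) x (oset_open U) ix) => y Uy a.
  split; first exact: ((sext_smooth sK 1).2 a).1 Uy.
  exact: (dsK (SigSub (mem_set Uy)) a).
have near_U : nbhs x (oset U).
  by apply: open_nbhs_nbhs; split => //; exact: oset_open.
apply: filterS2 near_x near_U => y syx Uy.
by rewrite -!sE.
Qed.

(** Ricci and [g] transform by the same congruence, and [g] is invertible, so the factor does not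
    depend on the chart. *)
Lemma schur_factor_invariant i j x : overlap i j x ->
  s i x = s j (transition i j x).
Proof.
move=> ov; have [ix dj] := ov; have [jy _] := transition_overlap ov.
apply: (@scale_unitmx_inj _ _ (g i x)) (mcomp_nondeg g ix) _.
  exact: leq_trans n3.
rewrite -ric_s // (ricci_transform g ov) ric_s // [in RHS](mcomp_transform g ov).
by rewrite -scalemxAr -scalemxAl.
Qed.

Theorem schur : connected [set: M] -> einstein g.
Proof.
move=> cM; pose ch p : Defs.index M := sval (cid (mfd_cover p)).
have chP p : cdom (ch p) p by rewrite /ch; case: cid.
(* Reads [s] in one chosen chart at each point; by [SE] every other chart gives the same value. *)
pose S p := s (ch p) (chart (ch p) p).
have SE i p : cdom i p -> S p = s i (chart i p).
  move=> ip; have := @schur_factor_invariant (ch p) i (chart (ch p) p).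
  rewrite /transition chartK //; apply; split; first exact: chart_img.
  by rewrite chartK.
have Sloc p : \forall q \near p, S q = S p.
  have ip := chP p.
  have near_c : nbhs p (chart (ch p) @^-1`
      [set y | s (ch p) y = s (ch p) (chart (ch p) p)]).
    exact: (chart_continuous ip) _ (schur_chart (chart_img ip)).
  have near_d : nbhs p (cdom (ch p)).
    by apply: open_nbhs_nbhs; split => //; exact: cdom_open.
  apply: filterS2 near_c near_d => q /= sq dq.
  by rewrite (SE _ _ dq) sq.
have Sc := locally_constant_connected cM Sloc.
(* An empty manifold has no base point to supply the constant; there 0 serves. *)
have [[p0 _]|M0] := pselect (exists p : M, True).
  exists (S p0) => i x ix; rewrite ric_s // (Sc p0 (param i x)).
  by rewrite (SE i) ?paramK //; exact: param_dom.
by exists 0 => i x ix; case: M0; exists (param i x).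
Qed.

End Schur.

(** * The soliton equation *)

Section Soliton.
Variables (R : realType) (n : nat) (M : manifold R n) (g : pseudo_metric M).
Variables (u lambda : smooth_fun M) (rho : R).
Hypothesis n3 : (3 <= n)%N.
Hypothesis hsol : gradient_almost_RB_soliton g u lambda rho.

Lemma einstein_hessian mu : einstein_with g mu ->
  exists psi : smooth_fun M, hessian_conformal g u psi.
Proof.
(* With scalar curvature [n%:R * mu], solving for the Hessian gives the factor [lambda] plus this
   constant, hence a smooth function. *)
move=> Emu; pose c := rho * (n%:R * mu) - mu.
have psi_smooth i : smooth_on (cimg i) (fun x => lambda (param i x) + c).
  move=> k; apply: Ck_add; first exact: cimg_open.
    exact: sfun_smooth.
  exact: smooth_cst.
exists (@SmoothFun _ _ M (fun p => lambda p + c) psi_smooth) => i x ix.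
have := hsol ix; rewrite (Emu i x ix).
rewrite (scalar_curvature_proportional ix (Emu i x ix)).
move=> /(canRL (addKr _)) ->; rewrite -scaleNr -scalerDl /= /c.
by congr (_ *: _); ring.
Qed.

Lemma hessian_einstein (psi : M -> R) : connected [set: M] ->
  hessian_conformal g u psi -> einstein g.
Proof.
move=> cM Hpsi.
apply: (@schur _ _ _ g n3 (fun i x => lambda (param i x)
  + rho * scalar_curvature g i x - psi (param i x))) => // i x ix.
by rewrite scalerBl -(hsol ix) (Hpsi i x ix) addrK.
Qed.

(** In a chart at [p] both sides of the soliton equation are multiples of the invertible matrix of
    [g], so their factors coincide. *)
Lemma soliton_function mu (psi : M -> R) p : einstein_with g mu ->
  hessian_conformal g u psi -> lambda p = (1 - n%:R * rho) * mu + psi p.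
Proof.
move=> Emu Hpsi; have [i ip] := mfd_cover p.
have ix := chart_img ip.
have := hsol ix; rewrite (Emu _ _ ix) (Hpsi _ _ ix).
rewrite (scalar_curvature_proportional ix (Emu _ _ ix)) chartK // -scalerDl.
have n0 : (0 < n)%N by exact: leq_trans n3.
move/(scale_unitmx_inj n0 (mcomp_nondeg g ix)) => E.
by rewrite -[LHS](addrK (rho * (n%:R * mu))) -E; ring.
Qed.

End Soliton.

Unset Implicit Arguments.

Theorem theorem5p4 (R : realType) (n1 n2 : nat)
    (hn1 : (0 < n1)%N) (hn2 : (0 < n2)%N) (hn : (3 <= n1 + n2)%N)
    (M1 : manifold R n1) (M2 : manifold R n2)
    (g1 : pseudo_metric M1) (g2 : pseudo_metric M2)
    (f phi : pos_smooth_fun (prod_manifold M1 M2))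
    (hconn : connected [set: prod_manifold M1 M2])
    (u lambda : smooth_fun (prod_manifold M1 M2)) (rho : R)
    (hsol : gradient_almost_RB_soliton (lyra_twisted_metric g1 g2 f phi)
              u lambda rho) :
  (einstein (lyra_twisted_metric g1 g2 f phi) <->
     exists psi : smooth_fun (prod_manifold M1 M2),
       hessian_conformal (lyra_twisted_metric g1 g2 f phi) u psi) /\
  (forall (mu : R) (psi : smooth_fun (prod_manifold M1 M2)),
     einstein_with (lyra_twisted_metric g1 g2 f phi) mu ->
     hessian_conformal (lyra_twisted_metric g1 g2 f phi) u psi ->
     forall p, lambda p = (1 - (n1 + n2)%:R * rho) * mu + psi p).
Proof.
split; first split.
- by move=> [mu Emu]; exact: (einstein_hessian hsol Emu).
- by move=> [psi Hpsi]; exact: (hessian_einstein hn hsol hconn Hpsi).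
- by move=> mu psi Emu Hpsi p; exact: (soliton_function hn hsol p Emu Hpsi).
Qed.
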